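(* Let $G$ be a compact group, let $W$ be a real Banach space, and let $\alpha$ be a strongly continuous representation of $G$ on $W$ by isometries. Let $V$ be a closed $\alpha$-invariant subspace of $W$. If a bounded linear projection from $W$ onto $V$ exists, then an $\alpha$-invariant bounded linear projection from $W$ onto $V$ exists (a projection $P$ being $\alpha$-invariant if $\alpha_g\circ P\circ\alpha_g^{-1}=P$ for all $g\in G$). This $\alpha$-invariant projection is unique if and only if $V$ is $\alpha$-full. If $V$ is $\alpha$-full, then this $\alpha$-invariant projection is a projection of minimal norm among all bounded linear projections from $W$ onto $V$.
   Context: Let $\tilde G$ be the set of equivalence classes of irreducible real representations of $G$ (all finite-dimensional). For $\gamma\in\tilde G$, the $\gamma$-isotypic component $W_\gamma$ of $W$ is the closed linear span of all finite-dimensional $\alpha$-invariant subspaces of $W$ on which $\alpha$ restricts to a representation equivalent to $\gamma$ (equivalently, the range of the projection $\alpha_{p_\gamma}$, the integrated form of the suitably normalized character $p_\gamma$ of $\gamma$). For an $\alpha$-invariant subspace $V$, its isotypic components are $V_\gamma=V\cap W_\gamma$. $V$ is called $\alpha$-full if $V_\gamma=W_\gamma$ for every $\gamma\in\tilde G$ with $V_\gamma\ne\{0\}$. *)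

(* Defs.v *)
From HB Require Import structures.
From mathcomp Require Import all_boot all_order all_algebra.
From mathcomp Require Import all_classical all_reals all_analysis.
Set Implicit Arguments. Unset Strict Implicit. Unset Printing Implicit Defensive.
Import Order.TTheory GRing.Theory Num.Theory.
Import numFieldNormedType.Exports.
Local Open Scope classical_set_scope.
Local Open Scope ring_scope.

Definition compact_group (G : topologicalType) (mul : G -> G -> G)
  (inv : G -> G) (e : G) : Prop :=
  [/\ (forall x y z, mul x (mul y z) = mul (mul x y) z),
      (forall x, mul e x = x /\ mul x e = x) &
      (forall x, mul (inv x) x = e /\ mul x (inv x) = e)] /\
  [/\ continuous (fun p : G * G => mul p.1 p.2),
      continuous inv,
      compact [set: G] & hausdorff_space G].

Section Defs.
Context (R : realType) (W : normedModType R).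

Definition is_linear_map (f : W -> W) : Prop :=
  forall (a : R) (x y : W), f (a *: x + y) = a *: f x + f y.

Definition is_bounded_linear (f : W -> W) : Prop :=
  is_linear_map f /\ exists c : R, forall x, `|f x| <= c * `|x|.

Definition is_lin_subspace (V : set W) : Prop :=
  V 0 /\ forall (a : R) x y, V x -> V y -> V (a *: x + y).

Definition opnorm (f : W -> W) : R :=
  sup [set `|f x| | x in [set x : W | `|x| <= 1]].

Definition is_projection_onto (V : set W) (P : W -> W) : Prop :=
  [/\ is_bounded_linear P, (forall x, V (P x)) & (forall x, V x -> P x = x)].

Variables (G : topologicalType) (mul : G -> G -> G) (inv : G -> G) (e : G).

Definition isometric_rep (alpha : G -> W -> W) : Prop :=
  [/\ (forall g, is_linear_map (alpha g)),
      (forall x, alpha e x = x),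
      (forall g h x, alpha (mul g h) x = alpha g (alpha h x)),
      (forall g x, `|alpha g x| = `|x|) &
      (forall x, continuous (fun g => alpha g x))].

Definition alpha_invariant_set (alpha : G -> W -> W) (V : set W) : Prop :=
  forall g x, V x -> V (alpha g x).

Definition alpha_invariant_map (alpha : G -> W -> W) (P : W -> W) : Prop :=
  forall g x, alpha g (P (alpha (inv g) x)) = P x.

Definition real_rep (n : nat) (rho : G -> 'M[R]_n) : Prop :=
  [/\ rho e = 1%:M,
      (forall g h, rho (mul g h) = rho g *m rho h) &
      (forall i j, continuous (fun g => rho g i j))].

Definition irreducible_real_rep (n : nat) (rho : G -> 'M[R]_n) : Prop :=
  [/\ real_rep rho, (0 < n)%N &
      forall S : set 'cV[R]_n,
        S 0 -> (forall (a : R) v w, S v -> S w -> S (a *: v + w)) ->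
        (forall g v, S v -> S (rho g *m v)) ->
        S = [set 0] \/ S = [set: 'cV[R]_n]].

(** T is a linear isomorphism from R^n onto a (finite-dimensional,
    alpha-invariant) subspace of W, intertwining rho and alpha: its range is
    an alpha-invariant subspace on which alpha is equivalent to rho *)
Definition intertwining_embedding (alpha : G -> W -> W) (n : nat)
  (rho : G -> 'M[R]_n) (T : 'cV[R]_n -> W) : Prop :=
  [/\ (forall (a : R) v w, T (a *: v + w) = a *: T v + T w),
      injective T &
      (forall g v, alpha g (T v) = T (rho g *m v))].

Definition lin_span (S : set W) : set W :=
  [set x | exists (k : nat) (c : 'I_k -> R) (s : 'I_k -> W),
     (forall i, S (s i)) /\ x = \sum_(i < k) c i *: s i].

Definition isotypic (alpha : G -> W -> W) (n : nat) (rho : G -> 'M[R]_n)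
  : set W :=
  closure (lin_span [set x | exists T : 'cV[R]_n -> W,
             intertwining_embedding alpha rho T /\ exists v, x = T v]).

Definition alpha_full (alpha : G -> W -> W) (V : set W) : Prop :=
  forall (n : nat) (rho : G -> 'M[R]_n), irreducible_real_rep rho ->
    (exists x, V x /\ isotypic alpha rho x /\ x <> 0) ->
    V `&` isotypic alpha rho = isotypic alpha rho.

End Defs.

(* Main.v *)
Require Import Defs.
From HB Require Import structures.
From mathcomp Require Import all_boot all_order all_algebra.
From mathcomp Require Import all_classical all_reals all_analysis.
From mathcomp Require Import lra ring.
Import Order.TTheory GRing.Theory Num.Theory.
Import numFieldNormedType.Exports.
Local Open Scope classical_set_scope.
Local Open Scope ring_scope.
Set Implicit Arguments. Unset Strict Implicit. Unset Printing Implicit Defensive.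

(** A continuous Banach-valued function on a compact group has an invariant mean,
    obtained after Maak and von Neumann: take a cover by a minimal number of sets
    on which all right translates of [f] oscillate by at most [eps]; by Hall's
    theorem every translate of this cover can be matched with the cover itself,
    so averaging [f] over one point per set is translation invariant up to [eps].

    Averaging the conjugates of a projection gives an invariant projection of no
    larger norm, so the minimality of the norm follows from uniqueness.

    If [V] is full and [D] is the difference of two invariant projections, suppose
    [D x <> 0], choose a functional [l] with [l (D x) <> 0] and put
    [u g := l (D (alpha g x))].  Convolution by [u] followed by its adjoint is a
    nonzero compact positive operator on [C(G)], and an eigenspace for its top
    eigenvalue is finite-dimensional, translation invariant and not orthogonal
    to [u].  Integrating [alpha g x] against it gives a finite-dimensional
    subrepresentation on which [D] does not vanish; one of minimal dimension is
    irreducible, [D] maps it isomorphically into [V], and fullness puts it inside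
    [V], where [D] vanishes.

    If [V] is not full, averaging a rank-one operator between a copy of the
    irreducible representation in the kernel of [P] and one in [V] gives a nonzero
    equivariant operator to be added to [P]; it is nonzero because averaging
    preserves the trace. *)

(** * Hall's marriage theorem *)

Section Hall.
Variables (T : finType) (r : rel T).

Let N (A Y : {set T}) : {set T} := finset (fun y => (y \in Y) && [exists x in A, r x y]).

Let NP (A Y : {set T}) y :
  reflect (y \in Y /\ exists2 x, x \in A & r x y) (y \in N A Y).
Proof.
rewrite inE; apply: (iffP andP) => -[yY].
  by move=> /exists_inP.
by move=> ?; split=> //; apply/exists_inP.
Qed.

(** Induction on the size of [X]. If some nonempty proper subset is tight, i.e. has exactly as many
    neighbours as elements, it and its complement are matched separately; otherwise an arbitrary
    edge is fixed and its two ends are removed. *)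
Lemma hall_marriage (X Y : {set T}) :
  (forall A : {set T}, A \subset X ->
     #|A| <= #|finset (fun y => (y \in Y) && [exists x in A, r x y])|)%N ->
  exists f : T -> T, {in X &, injective f} /\
    forall x, x \in X -> f x \in Y /\ r x (f x).
Proof.
have [n] := ubnP #|X|; elim: n X Y => // n IH X Y /ltnSE leXn hX.
have [->|X0] := eqVneq X finset.set0.
  by exists id; split => [x y|x]; rewrite inE.
have [/existsP[A /and3P[pAX A0 /eqP tA]]|nt] :=
    boolP [exists A : {set T}, [&& A \proper X, A != finset.set0 & #|A| == #|N A Y|]].
  have sAX := proper_sub pAX.
  have [||f1 [inj1 f1P]] := IH A Y.
  - exact: leq_trans (proper_card pAX) leXn.
  - by move=> B sBA; apply: hX; apply: fintype.subset_trans sAX.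
  have [||f2 [inj2 f2P]] := IH (X :\: A) (Y :\: N A Y).
  - by apply: leq_trans leXn; rewrite finset.cardsDS // ltn_subrL !card_gt0 A0 X0.
  - move=> B sB.
    have sBX : B \subset X := fintype.subset_trans sB (finset.subsetDl _ _).
    (* Subtracting the tight set [A] from Hall's condition for [A :|: B] leaves Hall's condition for
       [B] outside the neighbours of [A]. *)
    have := hX (A :|: B); rewrite finset.subUset sAX sBX => /(_ isT) h.
    have /eqP dAB : A :&: B == finset.set0.
      by rewrite finset.setI_eq0 disjoint_sym; move: sB; rewrite finset.subsetD => /andP[].
    rewrite finset.cardsU dAB cards0 subn0 tA in h.
    rewrite -(leq_add2l #|N A Y|); apply: (leq_trans h).
    apply: leq_trans (leq_card_setU _ _); apply: subset_leq_card.
    apply/fintype.subsetP => y /NP[yY [x xAB rxy]]; rewrite finset.in_setU.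
    have [//|yN] := boolP (y \in N A Y); rewrite /=.
    apply/NP; split; first by rewrite finset.in_setD yN.
    move: xAB; rewrite finset.in_setU => /orP[xA|xB]; last by exists x.
    by case/NP: yN; split=> //; exists x.
  exists (fun x => if x \in A then f1 x else f2 x); split.
    have sep x y : x \in A -> y \in X -> y \notin A -> f1 x <> f2 y.
      move=> xA yX yA E; have [] := f2P y; first by rewrite finset.in_setD yA.
      rewrite finset.in_setD -E => /andP[/NP[]]; have [? ?] := f1P _ xA.
      by split=> //; exists x.
    move=> x y xX yX; case: ifPn => xA; case: ifPn => yA.
    - exact: inj1.
    - by move=> /(sep _ _ xA yX yA).
    - by move=> /esym /(sep _ _ yA xX xA).
    - by apply: inj2; rewrite finset.in_setD ?xA ?yA.
  move=> x xX; case: ifPn => xA; first exact: f1P.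
  by have [] := f2P x; rewrite ?finset.in_setD ?xA // => /andP[_ ->].
have [x0 x0X] := finset.set0Pn _ X0.
have [y0 /NP[y0Y [x]]] : exists y0, y0 \in N (finset.set1 x0) Y.
  apply/finset.set0Pn; rewrite -card_gt0; apply: leq_trans (hX (finset.set1 x0) _).
    by rewrite cards1.
  by rewrite finset.sub1set.
rewrite finset.in_set1 => /eqP-> {x} r0.
have [||f [injf fP]] := IH (X :\ x0) (Y :\ y0).
- by move: leXn; rewrite (finset.cardsD1 x0 X) x0X.
- move=> B sB.
  have [->|B0] := eqVneq B finset.set0; first by rewrite cards0.
  have pBX : B \proper X.
    by apply: sub_proper_trans sB _; rewrite finset.properD1.
  (* No nonempty proper subset is tight, so [B] has a neighbour to spare and survives the loss of
     [y0]. *)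
  have := hX B (proper_sub pBX); rewrite leq_eqVlt => /orP[tB|].
    by case/negP: nt; apply/existsP; exists B; rewrite pBX B0.
  rewrite -/(N B Y) -/(N B (Y :\ y0)) (finset.cardsD1 y0 (N B Y)) => h.
  have {h} : (#|B| < 1 + #|N B Y :\ y0|)%N.
    by apply: (leq_trans h); rewrite leq_add2r; case: (_ \in _).
  rewrite add1n ltnS => /leq_trans; apply; apply: subset_leq_card.
  apply/fintype.subsetP => y; rewrite finset.in_setD1 => /andP[yy0 /NP[yY [x xB rxy]]].
  by apply/NP; split; [rewrite finset.in_setD1 yy0 | exists x].
exists (fun x => if x == x0 then y0 else f x); split.
  have sep y : y \in X -> y != x0 -> y0 <> f y.
    move=> yX yx E; have [] := fP y; first by rewrite finset.in_setD1 yx.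
    by rewrite finset.in_setD1 -E eqxx.
  move=> x y xX yX; have [->|xn] := eqVneq x x0; have [->|yn] := eqVneq y x0 => //.
  - by move=> /(sep _ yX yn).
  - by move=> /esym /(sep _ xX xn).
  - by apply: injf; rewrite finset.in_setD1 ?xn ?yn.
move=> x xX; have [->|xn] := eqVneq x x0; first by split.
by have [] := fP x; rewrite ?finset.in_setD1 ?xn // => /andP[_ ->].
Qed.
End Hall.

(** * Compactness and finite averages *)

Section Compactness.
Variable G : topologicalType.
Hypothesis cG : compact [set: G].

Lemma compact_finite_net (U : G -> set G) : (forall g, nbhs g (U g)) ->
  exists s : seq G, forall x, exists2 g, g \in s & U g x.
Proof.
move=> nU.
(* The filter generated by the lists that contain a given list: along it every point is eventually
   covered locally, and the near-covering form of compactness yields one list for all points. *)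
pose F : set_system (seq G) :=
  [set A | exists s0 : seq G, forall s : seq G, {subset s0 <= s} -> A s].
have FF : Filter F.
  split.
  - by exists [::].
  - move=> A B [s sA] [t tB]; exists (s ++ t) => v sv; split.
      by apply: sA => x xs; apply: sv; rewrite mem_cat xs.
    by apply: tB => x xs; apply: sv; rewrite mem_cat xs orbT.
  - by move=> A B AB [s sA]; exists s => v /sA /AB.
have /compact_near_coveringP := cG.
move=> /(_ _ F (fun (s : seq G) x => exists2 g, g \in s & U g x) FF)[].
  move=> x _; exists (U x, [set s : seq G | x \in s]) => /=.
    by split=> //; exists [:: x] => s; apply; rewrite inE.
  by move=> [y s] /= [Uy xs]; exists x.
by move=> s /(_ s (fun x xs => xs)) h; exists s => x; apply: h.
Qed.

(** The tube lemma: compactness of the second factor makes continuity in the first one uniform in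
    the second. *)
Lemma compact_tube (R : realType) (N : normedModType R) (X : topologicalType)
    (k : X * G -> N) : continuous k ->
  forall x (eps : R), 0 < eps ->
    \forall x' \near x, forall y, `|k (x', y) - k (x, y)| <= eps.
Proof.
move=> ck x eps e0.
have /compact_near_coveringP := cG.
move=> /(_ _ (nbhs x) (fun x' y => `|k (x', y) - k (x, y)| <= eps) (nbhs_filter x)) H; apply: filterS (H _).
  by move=> x' h y; apply: h.
move=> y _.
  have e2 : 0 < eps / 2 by rewrite divr_gt0.
  have /cvgrPdist_le /(_ _ e2) [[A B] /= [nA nB] AB] := ck (x, y).
  exists (B, A) => //= -[y' x'] /= [By Ax].
  have h1 := AB (x', y') (conj Ax By); have h2 := AB (x, y') (conj (nbhs_singleton nA) By).
  rewrite [eps]splitr -(subrKA (k (x, y))).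
  apply: le_trans (ler_normD _ _) _; rewrite lerD //.
  by rewrite distrC.
Qed.

Lemma compact_bounded_fun (R : realType) (N : normedModType R) (f : G -> N) :
  continuous f -> exists2 c : R, 0 <= c & forall x, `|f x| <= c.
Proof.
move=> cf.
have [g|s sP] := compact_finite_net (U := fun g => [set x | `|f g - f x| <= 1]).
  by have /cvgrPdist_le /(_ 1 ltr01) := cf g.
exists (1 + \sum_(g <- s) `|f g|); first by rewrite addr_ge0 ?ler01 ?sumr_ge0.
move=> x; have [g gs /= h] := sP x.
rewrite -[f x](subrK (f g)); apply: le_trans (ler_normD _ _) _.
rewrite lerD //; first by rewrite distrC.
rewrite (big_rem g) //= lerDl; exact: sumr_ge0.
Qed.
End Compactness.

Section Average.
Variables (R : realType) (G : Type) (N : normedModType R).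
Implicit Types (a b : seq G) (f g : G -> N).

(** Points may be repeated. The average over the empty list is [0], which is why nonemptiness is a
    recurring side condition. *)
Definition avg a f : N := (size a)%:R^-1 *: \sum_(x <- a) f x.

Lemma avg_cst a (w : N) : a <> [::] -> avg a (fun=> w) = w.
Proof.
move=> a0; rewrite /avg big_const_seq count_predT iter_addr_0 -[w *+ _]scaler_nat scalerA.
by rewrite mulVf ?scale1r // pnatr_eq0; case: a a0.
Qed.

Lemma avgB a f g : avg a (fun x => f x - g x) = avg a f - avg a g.
Proof. by rewrite /avg big_split sumrN scalerDr scalerN. Qed.

Lemma norm_avg_le a f c : 0 <= c -> (forall x, `|f x| <= c) -> `|avg a f| <= c.
Proof.
move=> c0 fc; rewrite /avg normrZ normfV normr_nat.
have [->|a0] := eqVneq (size a) 0%N; first by rewrite invr0 mul0r.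
rewrite mulrC ler_pdivrMr ?ltr0n ?lt0n //.
apply: le_trans (ler_norm_sum _ _ _) _.
apply: le_trans (ler_sum _ (fun x _ => fc x)) _.
by rewrite big_const_seq count_predT iter_addr_0 mulr_natr.
Qed.

Lemma avg_dist_le a f w c : a <> [::] ->
  (forall x, `|f x - w| <= c) -> `|avg a f - w| <= c.
Proof.
move=> a0 h; rewrite -{1}(avg_cst w a0) -avgB; apply: norm_avg_le => //.
by case: a a0 => // x _ _; apply: le_trans (h x).
Qed.

End Average.

Lemma avg_linear (R : realType) (G : Type) (N N' : normedModType R) (L : N -> N')
    a (f : G -> N) :
  (forall (c : R) x y, L (c *: x + y) = c *: L x + L y) ->
  avg a (fun x => L (f x)) = L (avg a f).
Proof.
move=> lin.
have L0 : L 0 = 0.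
  by have := lin (-1) 0 0; rewrite scaler0 add0r scaleN1r addNr.
rewrite /avg -[_ *: \sum_(x <- a) f x]addr0 lin L0 addr0; congr (_ *: _).
elim: a => [|x a IH]; first by rewrite !big_nil L0.
by rewrite !big_cons IH -{2}[f x]scale1r lin scale1r.
Qed.

Lemma avg_exchange (R : realType) (G H : Type) (N : normedModType R) (a : seq G)
    (b : seq H) (f : G -> H -> N) :
  avg a (fun x => avg b (f x)) = avg b (fun y => avg a (f^~ y)).
Proof.
rewrite /avg -!scaler_sumr exchange_big /= !scalerA; congr (_ *: _).
by rewrite mulrC.
Qed.

(** Passing to the opposite group turns each statement on left means into one on right means. *)
Lemma compact_group_op (G : topologicalType) mul inv e :
  @compact_group G mul inv e -> compact_group (fun x y => mul y x) inv e.
Proof.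
move=> [[mA m1 mV] [cm ci cG hG]]; split; split => //.
- by move=> x; have [] := m1 x.
- by move=> x; have [] := mV x.
- move=> -[x y] /=.
  apply: (@continuous_comp _ _ _ (fun p : G * G => (p.2, p.1)) (fun p => mul p.1 p.2)).
    by apply: cvg_pair; [exact: cvg_snd | exact: cvg_fst].
  exact: cm.
Qed.

(** * The invariant mean *)

Section Maak.
Variables (R : realType) (G : topologicalType) (N : normedModType R).
Variables (mul : G -> G -> G) (inv : G -> G) (e : G).
Hypothesis cg : compact_group mul inv e.

Lemma translate_avg_close (f : G -> N) (eps : R) : continuous f -> 0 < eps ->
  exists2 a : seq G, a <> [::] &
    forall z, `|avg a (fun x => f (mul x z)) - avg a f| <= eps.
Proof.
move: cg => [[mA m1 mV] [cm ci cG _]] cf e0.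
(* [Q] is stable under right translation of [U], which is what allows members of a cover to be
   replaced by translates. The tolerance is [eps / 2] because two such oscillations are added at the
   end. *)
pose Q (U : set G) := forall a b, U a -> U b -> forall y,
  `|f (mul a y) - f (mul b y)| <= eps / 2.
pose covers n := exists (I : finType) (U : I -> set G),
  [/\ #|I| = n, (forall i, Q (U i)) & forall x, exists i, U i x].
have ex_cov : exists n, `[< covers n >].
  have ck : continuous (fun p : G * G => f (mul p.1 p.2)).
    by move=> p; apply: continuous_comp; [exact: cm | exact: cf].
  have e4 : 0 < eps / 4 by rewrite divr_gt0.
  have [s sP] := compact_finite_net cG (fun x => compact_tube cG ck x e4).
  exists #|'I_(size s)|; apply/asboolP; exists 'I_(size s).
  exists (fun i : 'I_(size s) => [set x | forall y, `|f (mul x y) - f (mul (nth e s i) y)| <= eps / 4]).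
  split=> // [i a b /= ha hb y|x].
    have -> : eps / 2 = eps / 4 + eps / 4 by field.
    rewrite -(subrKA (f (mul (nth e s i) y))).
    apply: le_trans (ler_normD _ _) _; apply: lerD; first exact: ha.
    by rewrite distrC; exact: hb.
  have [g gs gx] := sP x; have hi : (index g s < size s)%N by rewrite index_mem.
  by exists (Ordinal hi) => /= y; rewrite nth_index //; apply: gx.
case: (ex_minnP ex_cov) => n /asboolP[I [U [cI QU covU]]] nmin.
have matching z : exists p : I -> I, injective p /\
    forall i, exists c d, [/\ U i c, U (p i) d & c = mul d z].
  (* [i] and [j] are related when [U i] meets the right translate of [U j] by [z]. *)
  pose r i j := `[< exists c d, [/\ U i c, U j d & c = mul d z] >].
  have [|p [injp pP]] := @hall_marriage I r finset.setT finset.setT.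
    move=> A _; rewrite leqNgt; apply/negP => ltJA.
    set J := finset _ in ltJA.
    (* If [A] had fewer neighbours [J] than elements, the sets [U i] for [i] outside [A] together
       with the translates of the [U j] for [j] in [J] would form a smaller cover, against the
       minimality of [n]. *)
    suff : (n <= #|~: A| + #|J|)%N.
      by rewrite leqNgt -cI -(cardsC A) addnC ltn_add2r ltJA.
    apply: nmin; apply/asboolP.
    exists ({i | i \in ~: A} + {j | j \in J})%type.
    exists (fun k => match k with inl i => U (val i)
      | inr j => [set x | exists2 d, U (val j) d & x = mul d z] end).
    split.
    - by rewrite card_sum !card_sig.
    - case=> [i|j]; first exact: QU.
      by move=> a b [a' ha ->] [b' hb ->] y; rewrite -!mA; apply: QU ha hb _.
    - move=> x; have [i xi] := covU x.
      have [iA|iA] := boolP (i \in A); last first.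
        have iC : i \in ~: A by rewrite finset.in_setC.
        by exists (inl (exist _ i iC)).
      have [j xj] := covU (mul x (inv z)).
      have xE : x = mul (mul x (inv z)) z by rewrite -mA (mV z).1 (m1 x).2.
      have jJ : j \in J.
        rewrite inE finset.in_setT; apply/exists_inP; exists i => //.
        by apply/asboolP; exists x, (mul x (inv z)).
      by exists (inr (exist _ j jJ)); exists (mul x (inv z)).
  exists p; split; first by move=> x y; apply: injp; rewrite finset.in_setT.
  by move=> i; have [_ /asboolP] := pP i (finset.in_setT i).
(* The matching at [e] is used to see that every set of the minimal cover is nonempty, so that a
   point [pt i] can be chosen in each. *)
have [p0 [_ p0P]] := matching e.
have /choice[pt ptP] : forall i, exists c, U i c.
  by move=> i; have [c [d []]] := p0P i; exists c.
have [i0 _] := covU e.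
have n0 : (0 < #|I|)%N by apply/card_gt0P; exists i0.
exists (map pt (enum I)).
  by move=> /(congr1 size); rewrite size_map -cardE => /= I0; rewrite I0 in n0.
move=> z; have [p [injp pP]] := matching z.
rewrite /avg !big_map. rewrite -enumT !big_enum /= (reindex_inj injp) /= -scalerBr -sumrB.
rewrite size_map -cardE normrZ normfV normr_nat mulrC ler_pdivrMr ?ltr0n //.
apply: le_trans (ler_norm_sum _ _ _) _.
rewrite mulr_natr -sumr_const; apply: ler_sum => i _.
(* The common point [c = mul d z] links the two values: [pt (p i)] and [d] share a set of the cover,
   and so do [c] and [pt i]. *)
have [c [d [ic pd cE]]] := pP i.
rewrite [eps]splitr -(subrKA (f (mul d z))).
apply: le_trans (ler_normD _ _) _; apply: lerD; first exact: QU (ptP _) pd _.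
by rewrite -cE -(m1 c).2 -(m1 (pt i)).2; apply: QU ic (ptP _) _.
Qed.
End Maak.

Section Mean.
Variables (R : realType) (G : topologicalType).

(** Uniformity in [z] pins down [w] as the normalised Haar integral of a continuous [f]. A right
    mean is a left mean for the opposite multiplication. *)
Definition lmean (N : normedModType R) (mul : G -> G -> G) (f : G -> N) (w : N) :=
  forall eps : R, 0 < eps -> exists2 a : seq G, a <> [::] &
    forall z, `|avg a (fun x => f (mul x z)) - w| <= eps.

(* Junk value [0] when there is no left mean. *)
Definition mean (N : normedModType R) (mul : G -> G -> G) (f : G -> N) : N :=
  xget 0 [set w | lmean mul f w].

(** The double average of [f (mul x y)] over [a] and [b] is close to [w] when summed over [a] first
    and close to [w'] when summed over [b] first. *)
Lemma lr_avg_close (N : normedModType R) (mul : G -> G -> G) (f : G -> N) a b w w'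
    (eps del : R) : a <> [::] -> b <> [::] ->
  (forall z, `|avg a (fun x => f (mul x z)) - w| <= eps) ->
  (forall z, `|avg b (fun y => f (mul z y)) - w'| <= del) ->
  `|w - w'| <= eps + del.
Proof.
move=> a0 b0 aw bw.
rewrite -(subrKA (avg a (fun x => avg b (fun y => f (mul x y))))).
apply: le_trans (ler_normD _ _) _; apply: lerD; last exact: avg_dist_le.
by rewrite avg_exchange distrC; apply: avg_dist_le.
Qed.

Lemma eq_of_dist_le (N : normedModType R) (x y : N) :
  (forall eps : R, 0 < eps -> `|x - y| <= eps) -> x = y.
Proof.
move=> h; apply/eqP; rewrite -subr_eq0 -normr_le0; apply/ler_addgt0Pr => eps e0.
by rewrite add0r; apply: h.
Qed.

Lemma lr_mean_unique (N : normedModType R) (mul : G -> G -> G) (f : G -> N) w w' :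
  lmean mul f w -> lmean (fun x y => mul y x) f w' -> w = w'.
Proof.
move=> lw rw; apply: eq_of_dist_le => eps e0.
have e2 : 0 < eps / 2 by rewrite divr_gt0.
have [a a0 aP] := lw _ e2; have [b b0 bP] := rw _ e2.
by rewrite [eps]splitr; apply: lr_avg_close a0 b0 aP bP.
Qed.

(** The sets [B d] of approximate left means of tolerance [d] generate a Cauchy filter, since all of
    them are compared with one right average; completeness gives the limit. *)
Lemma lmean_exists (W : completeNormedModType R) mul inv (e : G) (f : G -> W) :
  compact_group mul inv e -> continuous f -> exists w, lmean mul f w.
Proof.
move=> cg cf.
pose B (d : R) := [set w | exists2 a : seq G, a <> [::] &
  forall z, `|avg a (fun x => f (mul x z)) - w| <= d].
have Bex d : 0 < d -> exists w, B d w.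
  by move=> d0; have [a a0 aP] := translate_avg_close cg cf d0; exists (avg a f), a.
pose F : set_system W := [set A | exists2 d : R, 0 < d & B d `<=` A].
have FF : ProperFilter F.
  split; first by move=> [d d0 h]; have [w /h] := Bex _ d0.
  split.
  - by exists 1.
  - move=> A A' [d d0 dA] [d' d0' dA']; exists (Num.min d d').
      by rewrite lt_min d0.
    move=> w [a a0 aP]; split.
      by apply: dA; exists a => // z; apply: le_trans (aP z) _; rewrite ge_min lexx.
    by apply: dA'; exists a => // z; apply: le_trans (aP z) _; rewrite ge_min lexx orbT.
  - by move=> A A' AA' [d d0 dA]; exists d => // w /dA /AA'.
have cF : cvg F.
  apply/cauchy_cvgP/cauchy_ballP => eps e0.
  have e5 : 0 < eps / 5 by rewrite divr_gt0.
  exists (B (eps / 5), B (eps / 5)) => /=; first by split; exists (eps / 5).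
  move=> [w w'] /= [[a a0 aP] [a' a0' aP']].
  (* Each of [w] and [w'] lies within [2 * eps / 5] of the right average [avg b f], so their
     distance is strictly below [eps]. *)
  have [b b0 bP] := translate_avg_close (compact_group_op cg) cf e5.
  have h := lr_avg_close a0 b0 aP bP; have h' := lr_avg_close a0' b0 aP' bP.
  rewrite -ball_normE /= -(subrKA (avg b f)).
  apply: le_lt_trans (ler_normD _ _) _.
  rewrite [`|_ - w'|]distrC; apply: le_lt_trans (lerD h h') _; lra.
exists (lim F) => eps e0.
have e2 : 0 < eps / 2 by rewrite divr_gt0.
have : F (B (eps / 2) `&` [set w | `|lim F - w| <= eps / 2]).
  apply: filterI; first by exists (eps / 2).
  by have /cvgrPdist_le /(_ _ e2) : id @ F --> lim F by [].
move=> /filter_ex[w [[a a0 aP] /= wF]]; exists a => // z.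
rewrite [eps]splitr -(subrKA w); apply: le_trans (ler_normD _ _) _.
by rewrite lerD // distrC.
Qed.
End Mean.

(** * Linearity, invariance and continuity of the invariant mean *)

Section MeanTheory.
Variables (R : realType) (G : topologicalType).
Variables (mul : G -> G -> G) (inv : G -> G) (e : G).
Hypothesis cg : compact_group mul inv e.

Let cG : compact [set: G]. Proof. by case: cg => _ []. Qed.

Lemma continuous_mul (X : topologicalType) (f g : X -> G) : continuous f ->
  continuous g -> continuous (fun x => mul (f x) (g x)).
Proof.
move=> cf cg' x; have [_ [cm _ _ _]] := cg.
apply: (@continuous_comp _ _ _ (fun x => (f x, g x)) (fun p => mul p.1 p.2)).
  by apply: cvg_pair; [exact: cf | exact: cg'].
exact: cm.
Qed.

Lemma continuous_mull k : continuous (mul k).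
Proof. by apply: continuous_mul => x; [exact: cvg_cst | exact: cvg_id]. Qed.

Section General.
Variable W : completeNormedModType R.
Implicit Types (f h : G -> W).

Lemma meanP f : continuous f ->
  lmean mul f (mean mul f) /\ lmean (fun x y => mul y x) f (mean mul f).
Proof.
move=> cf; have [w lw] := lmean_exists cg cf.
have lm : lmean mul f (mean mul f) by rewrite /mean; case: xgetP => // /(_ w).
split=> //; have [w' rw'] := lmean_exists (compact_group_op cg) cf.
by rewrite (lr_mean_unique lm rw').
Qed.

Lemma mean_eql f w : continuous f -> lmean mul f w -> mean mul f = w.
Proof. by move=> /meanP[_ r] l; rewrite (lr_mean_unique l r). Qed.

Lemma mean_eqr f w : continuous f -> lmean (fun x y => mul y x) f w ->
  mean mul f = w.
Proof. by move=> /meanP[l _] r; rewrite (lr_mean_unique l r). Qed.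

Lemma mean_near f a w (eps : R) : continuous f -> a <> [::] ->
  (forall z, `|avg a (fun x => f (mul x z)) - w| <= eps) ->
  `|mean mul f - w| <= eps.
Proof.
move=> cf a0 aP; apply/ler_addgt0Pr => d d0.
have [_ /(_ _ d0)[b b0 bP]] := meanP cf.
by rewrite distrC; apply: lr_avg_close a0 b0 aP bP.
Qed.

End General.

(** One list has to serve both functions for the mean to be additive; it comes from averaging the
    pair [(f, h)] in the product space. *)
Lemma mean_approx2 (W W' : completeNormedModType R) (f : G -> W) (h : G -> W')
    (eps : R) : continuous f -> continuous h -> 0 < eps ->
  exists2 a : seq G, a <> [::] & forall z,
    `|avg a (fun x => f (mul x z)) - mean mul f| <= eps /\
    `|avg a (fun x => h (mul x z)) - mean mul h| <= eps.
Proof.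
move=> cf ch e0.
have e2 : 0 < eps / 2 by rewrite divr_gt0.
pose F x : (W * W')%type := (f x, h x).
have cF : continuous F.
  by move=> x; apply: cvg_pair; [exact: cf | exact: ch].
have [a a0 aP] := translate_avg_close cg cF e2; exists a => //.
have fstE (k : G -> (W * W')%type) : avg a (fun x => (k x).1) = (avg a k).1.
  exact: (@avg_linear R G (W * W')%type W fst).
have sndE (k : G -> (W * W')%type) : avg a (fun x => (k x).2) = (avg a k).2.
  exact: (@avg_linear R G (W * W')%type W' snd).
have aP1 z : `|avg a (fun x => f (mul x z)) - avg a f| <= eps / 2.
  rewrite (fstE (fun x => F (mul x z))) (fstE F).
  by apply: le_trans (aP z); rewrite [leRHS]prod_normE le_max lexx.
have aP2 z : `|avg a (fun x => h (mul x z)) - avg a h| <= eps / 2.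
  rewrite (sndE (fun x => F (mul x z))) (sndE F).
  by apply: le_trans (aP z); rewrite [leRHS]prod_normE le_max lexx orbT.
have n1 := mean_near cf a0 aP1; have n2 := mean_near ch a0 aP2.
move=> z; split.
  rewrite [eps]splitr -(subrKA (avg a f)); apply: le_trans (ler_normD _ _) _.
  by rewrite lerD // distrC.
rewrite [eps]splitr -(subrKA (avg a h)); apply: le_trans (ler_normD _ _) _.
by rewrite lerD // distrC.
Qed.

Lemma mean_dist_le (W : completeNormedModType R) (f : G -> W) w (c : R) :
  continuous f -> (forall x, `|f x - w| <= c) -> `|mean mul f - w| <= c.
Proof.
move=> cf fc; apply: (@mean_near _ f [:: e]) => // z; exact: avg_dist_le.
Qed.

Lemma mean_norm_le (W : completeNormedModType R) (f : G -> W) (c : R) :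
  continuous f -> (forall x, `|f x| <= c) -> `|mean mul f| <= c.
Proof.
by move=> cf fc; rewrite -[mean _ _]subr0; apply: mean_dist_le => // x; rewrite subr0.
Qed.

Lemma mean_cst (W : completeNormedModType R) (w : W) : mean mul (fun=> w) = w.
Proof.
apply: eq_of_dist_le => eps e0; apply: mean_dist_le.
  by move=> x; apply: cvg_cst.
by move=> _; rewrite subrr normr0 ltW.
Qed.

Lemma mean_linear_comp (W W' : completeNormedModType R) (L : W -> W') (c : R)
    (f : G -> W) :
  (forall (a : R) x y, L (a *: x + y) = a *: L x + L y) ->
  (forall x, `|L x| <= c * `|x|) -> continuous f ->
  continuous (fun x => L (f x)) /\ mean mul (fun x => L (f x)) = L (mean mul f).
Proof.
move=> lin Lc cf.
(* The given bound [c] may be zero or negative; [d] is a strictly positive bound by which one can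
   divide. *)
pose d := `|c| + 1.
have d0 : 0 < d by rewrite ltr_pwDr.
have LB x y : L x - L y = L (x - y).
  by rewrite addrC -scaleN1r -lin scaleN1r addrC.
have Ld x : `|L x| <= d * `|x|.
  apply: le_trans (Lc x) _; apply: ler_wpM2r => //.
  by apply: le_trans (ler_norm c) _; rewrite lerDl.
have cL : continuous (fun x => L (f x)).
  move=> x; apply/cvgrPdist_le => eps e0.
  have e1 : 0 < eps / d by rewrite divr_gt0.
  have /cvgrPdist_le /(_ _ e1) := cf x; apply: filterS => y h.
  by rewrite LB; apply: le_trans (Ld _) _; rewrite mulrC -ler_pdivlMr.
split=> //; apply: mean_eql => // eps e0.
have e1 : 0 < eps / d by rewrite divr_gt0.
have [/(_ _ e1)[a a0 aP] _] := meanP cf; exists a => // z.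
rewrite (@avg_linear _ _ _ _ L _ (fun x => f (mul x z))) // LB.
by apply: le_trans (Ld _) _; rewrite mulrC -ler_pdivlMr.
Qed.

Lemma mean_linear (W : completeNormedModType R) (f h : G -> W) (c : R) :
  continuous f -> continuous h ->
  mean mul (fun x => c *: f x + h x) = c *: mean mul f + mean mul h.
Proof.
move=> cf ch; apply: mean_eql.
  by move=> x; apply: cvgD; [apply: cvgZr; exact: cf | exact: ch].
move=> eps e0.
pose d := eps / (`|c| + 1).
have c1 : 0 < `|c| + 1 by rewrite ltr_pwDr.
have d0 : 0 < d by rewrite divr_gt0.
have [a a0 aP] := mean_approx2 cf ch d0; exists a => // z.
have -> : avg a (fun x => c *: f (mul x z) + h (mul x z)) =
    c *: avg a (fun x => f (mul x z)) + avg a (fun x => h (mul x z)).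
  by rewrite /avg big_split /= scalerDr -scaler_sumr !scalerA mulrC.
have [h1 h2] := aP z.
rewrite opprD addrACA -scalerBr; apply: le_trans (ler_normD _ _) _.
have -> : eps = `|c| * d + d.
  by rewrite -{2}[d]mul1r -mulrDl /d mulrC divfK // gt_eqF.
by rewrite lerD // normrZ ler_wpM2l.
Qed.

Lemma meanZ (W : completeNormedModType R) (f : G -> W) (c : R) :
  continuous f -> mean mul (fun x => c *: f x) = c *: mean mul f.
Proof.
move=> cf; have := @mean_linear W f (fun=> 0) c cf.
rewrite mean_cst addr0 => <-; last by move=> x; apply: cvg_cst.
by congr mean; apply/funext => x; rewrite addr0.
Qed.

Lemma meanD (W : completeNormedModType R) (f h : G -> W) :
  continuous f -> continuous h ->
  mean mul (fun x => f x + h x) = mean mul f + mean mul h.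
Proof.
move=> cf ch; rewrite -[mean mul f]scale1r -mean_linear //.
by congr mean; apply/funext => x; rewrite scale1r.
Qed.

Lemma continuous_sumf (W : completeNormedModType R) (X : topologicalType)
    (I : Type) (r : seq I) (f : I -> X -> W) :
  (forall i, continuous (f i)) -> continuous (fun x => \sum_(i <- r) f i x).
Proof.
move=> cf; elim: r => [|i r IH].
  rewrite (_ : (fun _ => _) = fun=> 0); first by move=> x; apply: cvg_cst.
  by apply/funext => x; rewrite big_nil.
rewrite (_ : (fun _ => _) = fun x => f i x + \sum_(i <- r) f i x).
  by move=> x; apply: cvgD; [exact: cf | exact: IH].
by apply/funext => x; rewrite big_cons.
Qed.

Lemma mean_sum (W : completeNormedModType R) (I : Type) (r : seq I)
    (f : I -> G -> W) : (forall i, continuous (f i)) ->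
  mean mul (fun x => \sum_(i <- r) f i x) = \sum_(i <- r) mean mul (f i).
Proof.
move=> cf; elim: r => [|i r IH].
  rewrite big_nil -[RHS](@mean_cst W 0); congr mean.
  by apply/funext => x; rewrite big_nil.
rewrite big_cons -IH -meanD //; last exact: continuous_sumf.
by congr mean; apply/funext => x; rewrite big_cons.
Qed.

(** The averages approximating a right mean do so uniformly in the translating element, and [k] is
    absorbed into that element. *)
Lemma mean_mull (W : completeNormedModType R) (f : G -> W) k :
  continuous f -> mean mul (fun x => f (mul k x)) = mean mul f.
Proof.
move=> cf; apply: mean_eqr.
  by move=> x; apply: continuous_comp; [exact: continuous_mull | exact: cf].
move=> eps e0; have [_ /(_ _ e0)[a a0 aP]] := meanP cf; exists a => // z.
have [[mA _ _] _] := cg.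
by under [fun _ => _]eq_fun do rewrite mA; exact: aP.
Qed.

Lemma mean_closed (W : completeNormedModType R) (V : set W) (f : G -> W) :
  closed V -> is_lin_subspace V -> continuous f -> (forall x, V (f x)) ->
  V (mean mul f).
Proof.
move=> cV [V0 VD] cf fV; apply: cV => B /nbhs_normP[eps /= e0 eB].
have e2 : 0 < eps / 2 by rewrite divr_gt0.
have [/(_ _ e2)[a a0 aP] _] := meanP cf.
exists (avg a (fun x => f (mul x e))); split; last first.
  apply: eB => /=; rewrite distrC; apply: le_lt_trans (aP e) _.
  by rewrite ltr_pdivrMr // ltr_pMr // ltr1n.
rewrite /avg -[_ *: _]addr0; apply: (VD _) => //.
elim: (a) => [|x b IH]; first by rewrite big_nil.
by rewrite big_cons -[f _]scale1r; apply: (VD _).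
Qed.

Lemma continuous_mean (W : completeNormedModType R) (X : topologicalType)
    (k : X * G -> W) : continuous k ->
  continuous (fun x => mean mul (fun y => k (x, y))).
Proof.
move=> ck x; apply/cvgrPdist_le => eps e0.
have ck1 x' : continuous (fun y => k (x', y)).
  move=> y; apply: (@continuous_comp _ _ _ (fun y => (x', y)) k); last exact: ck.
  by apply: cvg_pair; [exact: cvg_cst | exact: cvg_id].
have := compact_tube cG ck x e0; apply: filterS => x' h.
have -> : mean mul (fun y => k (x, y)) - mean mul (fun y => k (x', y)) =
    mean mul (fun y => (-1) *: k (x', y) + k (x, y)).
  by rewrite mean_linear // scaleN1r addrC.
apply: mean_norm_le.
  by move=> y; apply: cvgD; [apply: cvgZr; exact: ck1 | exact: ck1].
by move=> y; rewrite scaleN1r addrC distrC; apply: h.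
Qed.

End MeanTheory.

(** * The Hahn-Banach theorem *)

Section HahnBanach.
Variables (R : realType) (W : normedModType R).

Definition sublinear (p : W -> R) :=
  (forall x y, p (x + y) <= p x + p y) /\
  (forall (t : R) x, 0 <= t -> p (t *: x) = t * p x).

Let sub0 p : sublinear p -> p 0 = 0.
Proof. by move=> [_ /(_ 0 0 (lexx _))]; rewrite scale0r mul0r. Qed.

Let subN p x : sublinear p -> - p (- x) <= p x.
Proof.
move=> sp; rewrite lerNl -subr_ge0 opprK addrC -(sub0 sp) -(subrr x).
exact: sp.1.
Qed.

(** A sublinear functional below [p] whose value at [- y] is pushed down to at most [- p y]: take
    [t = 1] in the infimum. *)
Definition shrink (p : W -> R) (y x : W) : R :=
  inf [set p (x + t *: y) - t * p y | t in [set t : R | 0 <= t]].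

Let shrink_lb p y x : sublinear p ->
  lbound [set p (x + t *: y) - t * p y | t in [set t : R | 0 <= t]] (- p (- x)).
Proof.
move=> sp _ [t /= t0 <-]; have := sp.1 (x + t *: y) (- x).
rewrite [x + _]addrC addrK sp.2 //; lra.
Qed.

Let shrink_le p y x t : sublinear p -> 0 <= t ->
  shrink p y x <= p (x + t *: y) - t * p y.
Proof.
move=> sp t0; apply: ge_inf; last by exists t.
by exists (- p (- x)); apply: shrink_lb.
Qed.

Let shrink_ge p y x m : (forall t, 0 <= t -> m <= p (x + t *: y) - t * p y) ->
  m <= shrink p y x.
Proof.
move=> h; apply: lb_le_inf; first by exists (p (x + 0 *: y) - 0 * p y), 0 => /=.
by move=> _ [t t0 <-]; apply: h.
Qed.

Let shrink_sublinear p y : sublinear p -> sublinear (shrink p y).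
Proof.
move=> sp; split.
  move=> x x'; rewrite -lerBlDr; apply: shrink_ge => t t0.
  rewrite lerBlDr [leRHS]addrC -lerBlDr; apply: shrink_ge => s s0; rewrite lerBlDr.
  (* Parameters [t] for [x] and [s] for [x'] combine into [t + s] for the sum. *)
  apply: le_trans (shrink_le y (x + x') sp (addr_ge0 t0 s0)) _.
  have := sp.1 (x + t *: y) (x' + s *: y).
  rewrite addrACA -scalerDl; lra.
move=> t x; rewrite le_eqVlt => /orP[/eqP<-|t0].
  rewrite scale0r mul0r; apply/eqP; rewrite eq_le; apply/andP; split.
    have := shrink_le y 0 sp (lexx 0); rewrite scale0r addr0 (sub0 sp) mul0r subr0.
    exact.
  by apply: shrink_ge => s s0; rewrite add0r sp.2 // subrr.
apply/eqP; rewrite eq_le; apply/andP; split.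
  rewrite mulrC -ler_pdivrMr //; apply: shrink_ge => s s0; rewrite ler_pdivrMr //.
  apply: le_trans (shrink_le y (t *: x) sp (mulr_ge0 (ltW t0) s0)) _.
  rewrite -scalerA -scalerDr sp.2 ?(ltW t0) //; lra.
apply: shrink_ge => s s0; rewrite mulrC -ler_pdivlMr //.
apply: le_trans (shrink_le y x sp (divr_ge0 s0 (ltW t0))) _.
rewrite ler_pdivlMr // -[X in _ <= p (_ + X) - _](_ : t *: ((s / t) *: y) = _); last first.
  by rewrite scalerA mulrC divfK // gt_eqF.
rewrite -scalerDr sp.2 ?(ltW t0) // mulrBl [s / t * _ * _]mulrAC divfK ?gt_eqF //; lra.
Qed.

Let shrink_leW p y x : sublinear p -> shrink p y x <= p x.
Proof.
by move=> sp; have := shrink_le y x sp (lexx 0); rewrite scale0r addr0 mul0r subr0.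
Qed.

Lemma norm_sublinear : sublinear (fun x : W => `|x|).
Proof.
by split=> [x y|t x t0]; [exact: ler_normD | rewrite normrZ ger0_norm].
Qed.

(* The witness is a minimal sublinear functional below [p0]: replacing a sublinear
   [p] by [shrink p y] shows that minimality forces [p x + p y <= p (x + y)]. *)
Lemma linear_below_sublinear (p0 : W -> R) : sublinear p0 ->
  exists l : W -> R, (forall (a : R) x y, l (a *: x + y) = a * l x + l y) /\
    forall x, l x <= p0 x.
Proof.
move=> sp0.
pose K (p : W -> R) := sublinear p /\ forall x, p x <= p0 x.
pose T := {p : W -> R | K p}.
(* The order is reversed, so that a maximal element for Zorn's lemma is a pointwise minimal
   functional. *)
pose le (p q : T) : bool := `[< forall x, sval q x <= sval p x >].
have [||||[p [sp pp0]] pmin] := @Zorn T le.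
- by move=> p; apply/asboolP.
- move=> p q r /asboolP pq /asboolP qr; apply/asboolP => x.
  exact: le_trans (qr x) (pq x).
- move=> [p Pp] [q Pq] /asboolP /= pq /asboolP /= qp.
  apply: eq_exist; apply/funext => x.
  by apply/eqP; rewrite eq_le pq qp.
- move=> A tA.
  have [[q0 Aq0]|A0] := pselect (exists q, A q); last first.
    exists (exist K p0 (conj sp0 (fun=> lexx _))) => s As.
    by case: A0; exists s.
  (* A chain is bounded by its pointwise infimum, which is finite because [- p0 (- x)] lies below
     every member at [x]; subadditivity of the infimum uses that any two members are comparable. *)
  pose S x := [set sval q x | q in A].
  have Slb x : lbound (S x) (- p0 (- x)).
    move=> _ [q Aq <-]; apply: le_trans (subN _ (svalP q).1).
    by rewrite lerN2; apply: (svalP q).2.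
  have Sle x q : A q -> inf (S x) <= sval q x.
    by move=> Aq; apply: ge_inf; [exists (- p0 (- x)) | exists q].
  have Sge x m : (forall q, A q -> m <= sval q x) -> m <= inf (S x).
    move=> h; apply: lb_le_inf; first by exists (sval q0 x), q0.
    by move=> _ [q Aq <-]; apply: h.
  have sS : sublinear (fun x => inf (S x)).
    split.
      move=> x y; rewrite -lerBlDr; apply: (Sge _ _) => q Aq.
      rewrite lerBlDr [leRHS]addrC -lerBlDr; apply: (Sge _ _) => r Ar; rewrite lerBlDr.
      have [/asboolP qr|/asboolP rq] := tA _ _ Aq Ar.
        apply: le_trans (Sle _ _ Ar) _; apply: le_trans ((svalP r).1.1 _ _) _.
        by rewrite addrC lerD2l; apply: qr.
      apply: le_trans (Sle _ _ Aq) _; apply: le_trans ((svalP q).1.1 _ _) _.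
      by rewrite addrC lerD2r; apply: rq.
    move=> t x; rewrite le_eqVlt => /orP[/eqP<-|t0].
      rewrite scale0r mul0r; apply/eqP; rewrite eq_le; apply/andP; split.
        by apply: le_trans (Sle 0 _ Aq0) _; rewrite (sub0 (svalP q0).1).
      by apply: (Sge _ _) => q _; rewrite (sub0 (svalP q).1).
    apply/eqP; rewrite eq_le; apply/andP; split.
      rewrite mulrC -ler_pdivrMr //; apply: (Sge _ _) => q Aq; rewrite ler_pdivrMr //.
      apply: le_trans (Sle _ _ Aq) _.
      by rewrite (svalP q).1.2 ?(ltW t0) // mulrC.
    apply: (Sge _ _) => q Aq; rewrite (svalP q).1.2 ?(ltW t0) // ler_pM2l //.
    exact: Sle.
  have Sp0 x : inf (S x) <= p0 x.
    exact: le_trans (Sle _ _ Aq0) ((svalP q0).2 _).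
  exists (exist K _ (conj sS Sp0)) => q Aq; apply/asboolP => x /=.
  exact: Sle.
have add x y : p (x + y) = p x + p y.
  apply/eqP; rewrite eq_le sp.1 /=.
  have Ps : sublinear (shrink p y) /\ forall x, shrink p y x <= p0 x.
    split; first exact: shrink_sublinear.
    by move=> z; apply: le_trans (pp0 z); apply: shrink_leW.
  have /(congr1 sval) /= E := pmin (exist K _ Ps) (introT (asboolP _) (fun z => shrink_leW y z sp)).
  by have := shrink_le y x sp ler01; rewrite E scale1r mul1r lerBrDr.
exists p; split => // a x y; rewrite add; congr (_ + _).
have opp z : p (- z) = - p z.
  by apply/eqP; rewrite -addr_eq0 addrC -add subrr sub0.
have [a0|a0] := leP 0 a; first exact: sp.2.
have an : 0 <= - a by rewrite oppr_ge0 ltW.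
by rewrite -[a]opprK scaleNr opp sp.2 // -mulNr.
Qed.

(* Starting from [shrink `|.| w] instead of the norm makes [l w >= `|w|]. *)
Lemma norming_functional (w : W) : w <> 0 ->
  exists l : W -> R, [/\ (forall (a : R) x y, l (a *: x + y) = a * l x + l y),
    (forall x, `|l x| <= `|x|) & l w <> 0].
Proof.
move=> w0.
have [l [lin le]] := linear_below_sublinear (shrink_sublinear w norm_sublinear).
have l0 : l 0 = 0 by have := lin (-1) 0 0; rewrite scaler0 add0r mulN1r addNr.
have opp z : l (- z) = - l z.
  by rewrite -[- z]addr0 -scaleN1r lin l0 addr0 mulN1r.
have lb x : l x <= `|x| by apply: le_trans (le x) _; apply: shrink_leW norm_sublinear.
exists l; split=> //.
  by move=> x; rewrite ler_norml lb andbT lerNl -opp -normrN; apply: lb.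
move=> lw0.
have := le (- w); have := shrink_le w (- w) norm_sublinear ler01.
rewrite scale1r addNr normr0 mul1r sub0r opp lw0 oppr0 => h1 h2.
have := le_trans h2 h1; rewrite oppr_ge0 normr_le0.
by move=> /eqP.
Qed.
End HahnBanach.

(** * Compact positive operators on pre-Hilbert spaces *)

Section PreHilbert.
Variables (R : realType) (H : lmodType R) (C : set H) (ip : H -> H -> R).

(** The axioms are imposed on the subspace [C] alone: the intended case is that of continuous
    functions inside all functions [G -> R]. *)
Definition inner_product_on := [/\
  C 0 /\ (forall (a : R) x y, C x -> C y -> C (a *: x + y)),
  (forall x y, C x -> C y -> ip x y = ip y x),
  (forall (a : R) x y z, C x -> C y -> C z -> ip (a *: x + y) z = a * ip x z + ip y z),
  (forall x, C x -> 0 <= ip x x) &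
  (forall x, C x -> ip x x = 0 -> x = 0)].

Hypothesis ipP : inner_product_on.

Let C0 : C 0. Proof. by case: ipP => -[]. Qed.
Let CL a x y : C x -> C y -> C (a *: x + y).
Proof. by case: ipP => -[_ h] _ _ _ _; apply: h. Qed.
Let CZ a x : C x -> C (a *: x).
Proof. by move=> Cx; rewrite -[_ *: _]addr0; apply: CL. Qed.
Let CD x y : C x -> C y -> C (x + y).
Proof. by move=> Cx Cy; rewrite -[x]scale1r; apply: CL. Qed.
Let CB x y : C x -> C y -> C (x - y).
Proof. by move=> Cx Cy; rewrite addrC -scaleN1r; apply: CL. Qed.
Let Csum (I : Type) (r : seq I) (f : I -> H) : (forall i, C (f i)) ->
  C (\sum_(i <- r) f i).
Proof.
move=> Cf; elim: r => [|i r IH]; first by rewrite big_nil.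
by rewrite big_cons; apply: CD.
Qed.

Let ipC x y : C x -> C y -> ip x y = ip y x.
Proof. by case: ipP => _ h _ _ _; apply: h. Qed.
Let ipL a x y z : C x -> C y -> C z -> ip (a *: x + y) z = a * ip x z + ip y z.
Proof. by case: ipP => _ _ h _ _; apply: h. Qed.
Let ip_ge0 x : C x -> 0 <= ip x x.
Proof. by case: ipP => _ _ _ h _; apply: h. Qed.
Let ip_eq0 x : C x -> ip x x = 0 -> x = 0.
Proof. by case: ipP => _ _ _ _ h; apply: h. Qed.
Let ip0l z : C z -> ip 0 z = 0.
Proof.
by move=> Cz; have := ipL (-1) C0 C0 Cz; rewrite scaler0 add0r mulN1r addNr.
Qed.
Let ipZl a x z : C x -> C z -> ip (a *: x) z = a * ip x z.
Proof. by move=> Cx Cz; rewrite -[_ *: _]addr0 ipL // ip0l // addr0. Qed.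
Let ipDl x y z : C x -> C y -> C z -> ip (x + y) z = ip x z + ip y z.
Proof. by move=> Cx Cy Cz; rewrite -[x]scale1r ipL // mul1r scale1r. Qed.
Let ipBl x y z : C x -> C y -> C z -> ip (x - y) z = ip x z - ip y z.
Proof. by move=> Cx Cy Cz; rewrite addrC -scaleN1r ipL // mulN1r addrC. Qed.
Let ipZr a x z : C x -> C z -> ip x (a *: z) = a * ip x z.
Proof. by move=> Cx Cz; rewrite ipC ?ipZl ?(ipC Cx) //; exact: CZ. Qed.
Let ipDr x y z : C x -> C y -> C z -> ip z (x + y) = ip z x + ip z y.
Proof. by move=> Cx Cy Cz; rewrite ipC ?ipDl ?(ipC Cz) //; exact: CD. Qed.
Let ipBr x y z : C x -> C y -> C z -> ip z (x - y) = ip z x - ip z y.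
Proof. by move=> Cx Cy Cz; rewrite ipC ?ipBl ?(ipC Cz) //; exact: CB. Qed.

Let ip_suml (I : Type) (r : seq I) (f : I -> H) z : (forall i, C (f i)) -> C z ->
  ip (\sum_(i <- r) f i) z = \sum_(i <- r) ip (f i) z.
Proof.
move=> Cf Cz; elim: r => [|i r IH]; first by rewrite !big_nil ip0l.
by rewrite !big_cons ipDl ?IH //; exact: Csum.
Qed.

(** A statement about real quadratic polynomials, so that it applies both to [ip] and to the
    positive form [ip (A x) y]. *)
Lemma form_cauchy_schwarz (a b c : R) : 0 <= a -> 0 <= c ->
  (forall t, 0 <= a + 2 * t * b + t ^+ 2 * c) -> b ^+ 2 <= a * c.
Proof.
move=> a0 c0 h; have [cE|cN] := eqVneq c 0.
  have [->|bN] := eqVneq b 0; first by rewrite expr0n /= mulr_ge0.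
  (* At this [t] the remaining affine function takes the value [-1]. *)
  have := h (- (a + 1) / (2 * b)); rewrite cE mulr0 addr0.
  have -> : 2 * (- (a + 1) / (2 * b)) * b = - (a + 1) by field; rewrite bN.
  by lra.
have cp : 0 < c by rewrite lt_neqAle eq_sym cN.
have := h (- b / c).
have -> : a + 2 * (- b / c) * b + (- b / c) ^+ 2 * c = (a * c - b ^+ 2) / c.
  by field.
by rewrite pmulr_lge0 ?invr_gt0 // subr_ge0.
Qed.

Lemma ip_cauchy_schwarz x y : C x -> C y -> ip x y ^+ 2 <= ip x x * ip y y.
Proof.
move=> Cx Cy; apply: form_cauchy_schwarz; rewrite ?ip_ge0 // => t.
have Cty := CZ t Cy; have := ip_ge0 (CD Cx Cty).
rewrite ipDl ?ipDr ?ipZl ?ipZr ?(ipC Cy Cx) //; try exact: CD.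
by congr (_ <= _); ring.
Qed.

Lemma ip_sqD x y : C x -> C y -> ip (x + y) (x + y) <= 2 * (ip x x + ip y y).
Proof.
move=> Cx Cy; have := ip_ge0 (CB Cx Cy); have Cxy := CD Cx Cy.
have Cxy' := CB Cx Cy.
rewrite ipBl ?ipBr ?ipDl ?ipDr ?(ipC Cy Cx) //; lra.
Qed.

Definition orthonormal_fam n (b : 'I_n -> H) :=
  forall i j, ip (b i) (b j) = (i == j)%:R.

Lemma ip_orthonormal_sum n (b : 'I_n -> H) (c : 'I_n -> R) j :
  (forall i, C (b i)) -> orthonormal_fam b ->
  ip (\sum_i c i *: b i) (b j) = c j.
Proof.
move=> Cb ob; rewrite ip_suml //; last by move=> i; apply: CZ.
rewrite (bigD1 j) //= ipZl // ob eqxx mulr1 big1 ?addr0 // => i ij.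
by rewrite ipZl // ob (negbTE ij) mulr0.
Qed.

Let proj n (b : 'I_n -> H) x := \sum_i ip x (b i) *: b i.

Let proj_orth n (b : 'I_n -> H) x j : (forall i, C (b i)) -> orthonormal_fam b ->
  C x -> ip (x - proj b x) (b j) = 0.
Proof.
move=> Cb ob Cx.
have Cp : C (proj b x) by apply: Csum => i; apply: CZ.
by rewrite ipBl // ip_orthonormal_sum // subrr.
Qed.

Lemma ip_bessel n (b : 'I_n -> H) x : (forall i, C (b i)) -> orthonormal_fam b ->
  C x -> \sum_i ip x (b i) ^+ 2 <= ip x x.
Proof.
move=> Cb ob Cx.
have Cp : C (proj b x) by apply: Csum => i; apply: CZ.
have Cxp := CB Cx Cp; have := ip_ge0 Cxp.
have pE : ip (proj b x) (x - proj b x) = 0.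
  rewrite ip_suml //; last by move=> i; apply: CZ.
  by apply: big1 => i _; rewrite ipZl // [ip (b i) _]ipC // proj_orth // mulr0.
rewrite {1}ipBl // pE subr0 ipBr // subr_ge0; apply: le_trans.
rewrite ipC // ip_suml //; last by move=> i; apply: CZ.
by apply: ler_sum => i _; rewrite ipZl // (ipC (Cb i)).
Qed.

(** An orthonormal family of maximal size spans [E]: the normalised residual of a vector outside its
    span would enlarge it. *)
Lemma finite_orthonormal_basis (E : set H) (m : nat) : E `<=` C ->
  (forall (a : R) x y, E x -> E y -> E (a *: x + y)) ->
  (forall n (b : 'I_n -> H), (forall i, E (b i)) -> orthonormal_fam b -> (n <= m)%N) ->
  exists n (b : 'I_n -> H), [/\ (forall i, E (b i)), orthonormal_fam b &
    forall x, E x -> x = \sum_i ip x (b i) *: b i].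
Proof.
move=> EC EL Em.
pose P n := `[< exists b : 'I_n -> H, (forall i, E (b i)) /\ orthonormal_fam b >].
have P0 : exists n, P n.
  by exists 0%N; apply/asboolP; exists (fun=> 0); split => [[]|[]].
have Pm n : P n -> (n <= m)%N by move=> /asboolP[b [bE /(Em _ _ bE)]].
case: (ex_maxnP P0 Pm) => n /asboolP[b [bE ob]] nmax.
exists n, b; split=> // x Ex.
apply: contrapT => xN.
have Cb i : C (b i) by apply: EC.
have Esum (r : seq 'I_n) : E (x - \sum_(i <- r) ip x (b i) *: b i).
  elim: r => [|i r IH]; first by rewrite big_nil subr0.
  by rewrite big_cons opprD addrCA -scaleNr; apply: EL.
pose y := x - proj b x.
have Ey : E y by apply: Esum.
have Cy := EC _ Ey; have Cx := EC _ Ex.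
have y0 : 0 < ip y y.
  rewrite lt_neqAle ip_ge0 // andbT eq_sym; apply/eqP => /(ip_eq0 Cy) yE.
  by apply: xN; apply/eqP; rewrite -subr_eq0; apply/eqP.
pose c := (Num.sqrt (ip y y))^-1.
(* The normalised residual is placed last; the summand [0] gives it the shape [a *: x + y] of the
   closure hypothesis [EL]. *)
pose b' (i : 'I_n.+1) := if unlift ord_max i is Some j then b j else c *: y + 0.
have Ez : E 0.
  by have := EL (-1) y y Ey Ey; rewrite scaleN1r addNr.
suff : P n.+1 by move=> /nmax; rewrite ltnn.
apply/asboolP; exists b'; split.
  by move=> i; rewrite /b'; case: (unlift _ _) => [j|] //; apply: EL.
have yb j : ip y (b j) = 0 by exact: proj_orth.
have Cc := CZ c Cy.
move=> i j; rewrite /b' addr0.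
case: (unliftP ord_max i) => [i'|] ->; case: (unliftP ord_max j) => [j'|] ->.
- by rewrite ob (inj_eq lift_inj).
- by rewrite ipZr // ipC // yb mulr0 eq_sym (negbTE (neq_lift _ _)).
- by rewrite ipZl // yb mulr0 (negbTE (neq_lift _ _)).
- rewrite ipZl // ipZr // eqxx mulrA -expr2 /c exprVn sqr_sqrtr ?ltW //.
  by rewrite mulVf // gt_eqF.
Qed.

Section Eigen.
Variable A : H -> H.
Hypothesis AC : forall x, C x -> C (A x).
Hypothesis AL : forall (a : R) x y, C x -> C y -> A (a *: x + y) = a *: A x + A y.
Hypothesis Asym : forall x y, C x -> C y -> ip (A x) y = ip x (A y).
Hypothesis Apos : forall x, C x -> 0 <= ip (A x) x.
Hypothesis Abnd : exists c, forall x, C x -> ip (A x) x <= c * ip x x.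
(** Compactness of [A] as the existence of a cluster point of the images of a bounded sequence; no
    subsequence is extracted, and distances stay squared. *)
Hypothesis Acpt : forall f : nat -> H, (forall n, C (f n) /\ ip (f n) (f n) <= 1) ->
  exists2 v, C v & forall (eps : R) n0, 0 < eps ->
    exists2 n, (n0 <= n)%N & ip (A (f n) - v) (A (f n) - v) <= eps.
Hypothesis A0 : exists2 x, C x & 0 < ip (A x) x.

(** With [lam] the supremum of the quadratic form on the unit ball, a maximising sequence [f]
    satisfies [A (f n) - lam *: f n -> 0], so a cluster point of [A (f n)] is an eigenvector for
    [lam]. *)
Lemma compact_positive_eigenvector :
  exists (lam : R) v, [/\ 0 < lam, C v, v <> 0 & A v = lam *: v].
Proof.
have A00 : A 0 = 0.
  by have := AL (-1) C0 C0; rewrite scaler0 add0r scaleN1r addNr.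
have AZ a x : C x -> A (a *: x) = a *: A x.
  by move=> Cx; rewrite -[a *: x]addr0 AL // A00 addr0.
have AD x y : C x -> C y -> A (x + y) = A x + A y.
  by move=> Cx Cy; rewrite -[x]scale1r AL // !scale1r.
have AB x y : C x -> C y -> A (x - y) = A x - A y.
  by move=> Cx Cy; rewrite addrC -scaleN1r AL // scaleN1r addrC.
pose S := [set ip (A x) x | x in [set x | C x /\ ip x x <= 1]].
have [c cP] := Abnd.
have S0 : S !=set0.
  by exists (ip (A 0) 0), 0 => //; split => //; rewrite ip0l.
have Sub : has_ubound S.
  exists `|c| => _ [x [Cx x1] <-]; apply: le_trans (cP x Cx) _.
  apply: le_trans (ler_wpM2r (ip_ge0 Cx) (ler_norm c)) _.
  by rewrite ler_piMr.
pose lam := sup S.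
have lamP x : C x -> ip (A x) x <= lam * ip x x.
  move=> Cx; have [x0|xN] := eqVneq (ip x x) 0.
    by rewrite (ip_eq0 Cx x0) A00 !ip0l // mulr0.
  have xp : 0 < ip x x by rewrite lt_neqAle eq_sym xN ip_ge0.
  rewrite -ler_pdivrMr //; apply: ub_le_sup => //.
  pose a := (Num.sqrt (ip x x))^-1; have Ca := CZ a Cx; have CA := AC Cx.
  have aE : a * a = (ip x x)^-1 by rewrite -expr2 exprVn sqr_sqrtr // ltW.
  exists (a *: x).
    by split=> //; rewrite ipZl // ipZr // mulrA aE mulVf.
  by rewrite AZ // ipZl ?ipZr ?(CZ a CA) // mulrA aE mulrC.
have lam0 : 0 < lam.
  have [x Cx x0] := A0; have := lt_le_trans x0 (lamP x Cx).
  have := ip_ge0 Cx; rewrite le_eqVlt => /orP[/eqP<-|xp].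
    by rewrite mulr0 ltxx.
  by rewrite pmulr_lgt0.
(* Cauchy-Schwarz for the positive form [ip (A x) y], applied to [x] and [A x]. *)
have Asq x : C x -> ip (A x) (A x) <= lam * ip (A x) x.
  move=> Cx; have CA := AC Cx; have CAA := AC CA.
  have h : ip (A x) (A x) ^+ 2 <= ip (A x) x * ip (A (A x)) (A x).
    apply: form_cauchy_schwarz; rewrite ?Apos // => t.
    have Ct := CZ t CA; have := Apos (CD Cx Ct).
    rewrite AD // AZ // ipDl ?ipDr ?ipZl ?ipZr //; try exact: CZ; try exact: CD.
    rewrite (Asym CA Cx); congr (_ <= _); ring.
  have {h} : ip (A x) (A x) ^+ 2 <= ip (A x) x * (lam * ip (A x) (A x)).
    by apply: le_trans h _; apply: ler_wpM2l; [exact: Apos | exact: lamP].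
  have := ip_ge0 CA; rewrite le_eqVlt => /orP[/eqP<-|p0] h.
    by rewrite mulr_ge0 ?Apos // ltW.
  by move: h; rewrite expr2 mulrA ler_pM2r // mulrC.
have Asq2 x : C x -> ip (A x) (A x) <= lam ^+ 2 * ip x x.
  move=> Cx; apply: le_trans (Asq x Cx) _; rewrite expr2 -mulrA.
  by apply: ler_wpM2l; [exact: ltW | exact: lamP].
have /choice[f fP] : forall n : nat, exists x,
    [/\ C x, ip x x <= 1 & lam - n.+1%:R^-1 < ip (A x) x].
  move=> n; have n0 : 0 < n.+1%:R^-1 :> R by rewrite invr_gt0 ltr0n.
  have [_ [x [Cx x1] <-] h] := sup_adherent n0 (conj S0 Sub).
  by exists x.
have [|v Cv vP] := Acpt (f := f); first by move=> n; have [] := fP n.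
exists lam, v; split=> //.
(* For large [n] the form at [f n] exceeds [lam / 2], which keeps [A (f n)] away from [0]. *)
- move=> v0; have l2 : 0 < lam / 2 by rewrite divr_gt0.
  have l4 : 0 < (lam / 2) ^+ 2 / 2 by rewrite divr_gt0 ?exprn_gt0.
  have [N _ NP] := near_infty_natSinv_lt (PosNum l2).
  have [n nN hn] := vP _ N l4.
  have [Cf f1 fl] := fP n; have CA := AC Cf; rewrite v0 subr0 in hn.
  have := ip_cauchy_schwarz CA Cf.
  have : (lam / 2) ^+ 2 <= ip (A (f n)) (f n) ^+ 2.
    rewrite ler_sqr ?nnegrE ?(ltW l2) ?Apos //.
    by move: fl (NP n nN) => /=; move: (n.+1%:R^-1) => q; lra.
  have : ip (A (f n)) (A (f n)) * ip (f n) (f n) <= (lam / 2) ^+ 2 / 2.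
    by apply: le_trans hn; apply: ler_piMr => //; exact: ip_ge0.
  lra.
apply/eqP; rewrite -subr_eq0; apply/eqP.
have CAv := AC Cv; have Clv := CZ lam Cv.
apply: ip_eq0; first exact: CB.
apply/eqP; rewrite eq_le ip_ge0 ?andbT; last exact: CB.
apply/ler_addgt0Pr => eps e0; rewrite add0r.
(* [A v - lam *: v] is split into three terms of squared norm at most [lam ^+ 2 * d]; two uses of
   [ip_sqD] weight them by 2, 4 and 4, which add up to 10. *)
pose d := eps / (10 * lam ^+ 2).
have ls : 0 < lam ^+ 2 by rewrite exprn_gt0.
have d0 : 0 < d by rewrite divr_gt0 // mulr_gt0.
have dl : 0 < d / lam by rewrite divr_gt0.
have [N _ NP] := near_infty_natSinv_lt (PosNum dl).
have [n nN hn] := vP _ N d0.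
have [Cf f1 fl] := fP n; have CA := AC Cf; have CAA := AC CA.
set w := A (f n) in hn CA CAA.
have Clf := CZ lam Cf.
pose r := w - lam *: f n.
have Cr : C r by exact: CB.
(* Expanding the square and using [Asq] bounds it by [lam * (lam - ip w (f n))], which is small
   along the maximising sequence. *)
have rE : ip r r <= d.
  rewrite /r ipBl ?ipBr ?ipZl ?ipZr //; try exact: CB.
  rewrite (ipC Cf CA).
  have := Asq _ Cf; rewrite -/w => h.
  have h2 : lam * (lam * ip (f n) (f n)) <= lam * lam.
    by rewrite ler_pM2l // ler_piMr // ltW.
  have /= h3 := NP n nN; rewrite ltr_pdivlMr // in h3.
  have h4 : lam * (lam - n.+1%:R^-1) <= lam * ip w (f n) by rewrite ler_pM2l // ltW.
  by move: h3 h4 h h2; move: (n.+1%:R^-1) => q; lra.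
have vw : ip (v - w) (v - w) <= d.
  have <- : ip (w - v) (w - v) = ip (v - w) (v - w); last exact: hn.
  rewrite !ipBl ?ipBr //; try exact: CB; ring.
have -> : A v - lam *: v = A (v - w) + (A r + lam *: (w - v)).
  rewrite AB // /r AB // AZ // -/w scalerBr.
  by rewrite -!addrA addKr addKr.
have Cvw := CB Cv CA; have Cwv := CB CA Cv.
have h1 := Asq2 _ Cvw; have h2 := Asq2 _ Cr.
have C1 := AC Cvw; have C2 := AC Cr; have C3 := CZ lam Cwv.
have h3 := ip_sqD C1 (CD C2 C3); have h4 := ip_sqD C2 C3.
have h5 : ip (lam *: (w - v)) (lam *: (w - v)) <= lam ^+ 2 * d.
  by rewrite ipZl // ipZr // mulrA -expr2 ler_pM2l.
have h6 : lam ^+ 2 * ip (v - w) (v - w) <= lam ^+ 2 * d by rewrite ler_pM2l.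
have h7 : lam ^+ 2 * ip r r <= lam ^+ 2 * d by rewrite ler_pM2l.
have h8 : lam ^+ 2 * d = eps / 10 by rewrite /d; field; rewrite gt_eqF.
lra.
Qed.
End Eigen.
End PreHilbert.

(** * Cluster points of equicontinuous sequences, and Fubini *)

(** Ascoli's theorem by an ultrafilter on the indices: [v] is the pointwise ultralimit, and
    equicontinuity makes it continuous and upgrades closeness on a finite net to uniform
    closeness. *)
Lemma equicontinuous_cluster (R : realType) (G : topologicalType) (F : nat -> G -> R)
    (c : R) : compact [set: G] -> (forall n h, `|F n h| <= c) ->
  (forall h (eps : R), 0 < eps -> \forall h' \near h, forall n, `|F n h' - F n h| <= eps) ->
  exists2 v : G -> R, continuous v & forall (eps : R) n0, 0 < eps ->
    exists2 n, (n0 <= n)%N & forall h, `|F n h - v h| <= eps.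
Proof.
move=> cG Fc Feq.
have [U [UU sU]] := ultraFilterLemma eventually_filter.
have PU : ProperFilter U by exact: ultra_proper.
have UI A B : U A -> U B -> exists n, A n /\ B n.
  by move=> UA UB; have /filter_ex : U (A `&` B) by exact: filterI.
have /choice[v vP] : forall h, exists y, forall eps : R, 0 < eps ->
    U [set n | `|y - F n h| <= eps].
  move=> h; have := @segment_compact R (- c) c => /(_ (F ^~ h @ U) _)[].
    apply: (@filterE _ U) => n /=; rewrite in_itv /= -ler_norml; exact: Fc.
  move=> y [_ cy]; exists y => eps e0.
  set A := [set n | _]; have [//|nA] := in_ultra_setVsetC A UU.
  have [||z [/= zN zB]] := cy (~` [set z | `|y - z| <= eps]) [set z | `|y - z| <= eps].
  - exact: nA.
  - by apply/nbhs_normP; exists eps => //= z /= /ltW.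
  - by [].
exists v.
  move=> h; apply/cvgrPdist_le => eps e0.
  have e3 : 0 < eps / 3 by rewrite divr_gt0.
  have := Feq h _ e3; apply: filterS => h' hF.
  have [n [/= h1 h2]] := UI _ _ (vP h _ e3) (vP h' _ e3).
  rewrite -(subrKA (F n h)) -(subrKA (F n h') (F n h)).
  apply: le_trans (ler_normD _ _) _.
  have := ler_normD (F n h - F n h') (F n h' - v h').
  have := hF n; rewrite distrC [`|F n h' - v h'|]distrC; lra.
move=> eps n0 e0.
(* Five errors arise on the way from [F n h] through [F n g], [v g], [F m g] and [F m h] to [v h].
   The index [n] is the same for all [h], whereas [m] depends on [h]. *)
have e4 : 0 < eps / 5 by rewrite divr_gt0.
have [s sP] := compact_finite_net cG (fun h => Feq h _ e4).
have Us : U [set n | forall g, g \in s -> `|v g - F n g| <= eps / 5].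
  elim: s {sP} => [|g s IH]; first by apply: filterE => n.
  apply: filterS (filterI (vP g _ e4) IH) => n [/= h1 h2] g'.
  by rewrite inE => /orP[/eqP->|/h2].
have Un : U [set n | (n0 <= n)%N] by apply: sU; exists n0.
have nearh h : exists g, g \in s /\ (forall n, `|F n h - F n g| <= eps / 5).
  by have [g gs /= hg] := sP h; exists g.
have [n [/= h1 h2]] := UI _ _ Us Un; exists n => // h.
have [g [gs hg]] := nearh h.
have [m [/= k1 k2]] := UI _ _ (vP h _ e4) (vP g _ e4).
have := h1 g gs; have := hg n; have := hg m; move: k1 k2.
move: (F n h) (F n g) (v h) (v g) (F m h) (F m g) => a b p q r t.
rewrite !ler_norml; lra.
Qed.

Section ProductGroup.
Variables (G : topologicalType) (mul : G -> G -> G) (inv : G -> G) (e : G).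
Hypothesis cg : compact_group mul inv e.

Definition mul2 (p q : G * G) : G * G := (mul p.1 q.1, mul p.2 q.2).

Lemma compact_group2 :
  compact_group mul2 (fun p => (inv p.1, inv p.2)) (e, e).
Proof.
have [[mA m1 mV] [cm ci cG hG]] := cg.
have c1 : continuous (fun p : G * G => p.1) by move=> p; exact: cvg_fst.
have c2 : continuous (fun p : G * G => p.2) by move=> p; exact: cvg_snd.
split; split.
- by move=> x y z; rewrite /mul2 /= !mA.
- by move=> [x y]; rewrite /mul2 /= (m1 x).1 (m1 x).2 (m1 y).1 (m1 y).2.
- by move=> [x y]; rewrite /mul2 /= (mV x).1 (mV x).2 (mV y).1 (mV y).2.
- have d1 : continuous (fun p : (G * G) * (G * G) => p.1) by move=> p; exact: cvg_fst.
  have d2 : continuous (fun p : (G * G) * (G * G) => p.2) by move=> p; exact: cvg_snd.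
  have m1c : continuous (fun q : (G * G) * (G * G) => mul q.1.1 q.2.1).
    apply: (continuous_mul cg) => q; first exact: (continuous_comp (d1 q) (c1 _)).
    exact: (continuous_comp (d2 q) (c1 _)).
  have m2c : continuous (fun q : (G * G) * (G * G) => mul q.1.2 q.2.2).
    apply: (continuous_mul cg) => q; first exact: (continuous_comp (d1 q) (c2 _)).
    exact: (continuous_comp (d2 q) (c2 _)).
  by move=> p; apply: cvg_pair; [exact: m1c | exact: m2c].
- move=> p; apply: cvg_pair.
    exact: (continuous_comp (c1 p) (ci _)).
  exact: (continuous_comp (c2 p) (ci _)).
- by rewrite -setXTT; apply: compact_setX.
- move=> [x y] [x' y'] cl; congr pair; apply: hG => A B nA nB.
    have [||[z1 z2] [[/= ? _] [? _]]] := cl (A `*` setT) (B `*` setT).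
    + by exists (A, setT) => //; split => //; exact: filterT.
    + by exists (B, setT) => //; split => //; exact: filterT.
    by exists z1.
  have [||[z1 z2] [[/= _ ?] [_ ?]]] := cl (setT `*` A) (setT `*` B).
  + by exists (setT, A) => //; split => //; exact: filterT.
  + by exists (setT, B) => //; split => //; exact: filterT.
  by exists z2.
Qed.

Lemma continuous_swap (X Y : topologicalType) : continuous (fun p : X * Y => (p.2, p.1)).
Proof. by move=> p; apply: cvg_pair; [exact: cvg_snd | exact: cvg_fst]. Qed.

Lemma continuous_section1 (X Y Z : topologicalType) (k : X * Y -> Z) x :
  continuous k -> continuous (fun y => k (x, y)).
Proof.
move=> ck y; apply: (@continuous_comp _ _ _ (fun y => (x, y)) k); last exact: ck.
by apply: cvg_pair; [exact: cvg_cst | exact: cvg_id].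
Qed.

Lemma continuous_section2 (X Y Z : topologicalType) (k : X * Y -> Z) y :
  continuous k -> continuous (fun x => k (x, y)).
Proof.
move=> ck x; apply: (@continuous_comp _ _ _ (fun x => (x, y)) k); last exact: ck.
by apply: cvg_pair; [exact: cvg_id | exact: cvg_cst].
Qed.

Lemma continuous_comp_mull (Z : topologicalType) (f : G -> Z) k :
  continuous f -> continuous (fun x => f (mul k x)).
Proof. by move=> cf x; apply: continuous_comp; [exact: (continuous_mull cg) | exact: cf]. Qed.

Variables (R : realType) (W : completeNormedModType R).

Lemma mean_avg (T : Type) (a : seq T) (f : T -> G -> W) :
  (forall t, continuous (f t)) ->
  mean mul (fun x => avg a (f ^~ x)) = avg a (fun t => mean mul (f t)).
Proof.
move=> cf; rewrite /avg (meanZ cg) ?(mean_sum cg) //.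
exact: continuous_sumf.
Qed.

(* Both iterated means agree with the mean on the product group. *)
Lemma mean_fubini (k : G * G -> W) : continuous k ->
  mean mul (fun x => mean mul (fun y => k (x, y))) =
  mean mul (fun y => mean mul (fun x => k (x, y))).
Proof.
move=> ck.
have ck1 x : continuous (fun y => k (x, y)) by exact: continuous_section1.
have ck2 y : continuous (fun x => k (x, y)) by exact: continuous_section2.
have cK := continuous_mean cg ck.
have cK' : continuous (fun y => mean mul (fun x => k (x, y))).
  apply: (@continuous_mean _ _ _ _ _ cg _ _ (fun p => k (p.2, p.1))) => p.
  exact: (continuous_comp (@continuous_swap _ _ p) (ck _)).
have [lm _] := meanP compact_group2 ck.
set N := mean mul2 k in lm.
suff h eps : 0 < eps -> `|mean mul (fun x => mean mul (fun y => k (x, y))) - N| <= eps /\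
    `|mean mul (fun y => mean mul (fun x => k (x, y))) - N| <= eps.
  transitivity N; apply: eq_of_dist_le => eps /h[] //.
  by rewrite (distrC N).
move=> e0; have [a a0 aP] := lm _ e0; split.
  apply: (@mean_near _ _ _ _ _ cg _ _ (map fst a)) => //; first by case: (a) a0.
  move=> x.
  (* Invariance of the inner mean inserts [p.2], so that the list chosen for the product group can
     be used. *)
  have -> : avg [seq i.1 | i <- a] (fun x0 => mean mul (fun y => k (mul x0 x, y))) =
      avg a (fun p => mean mul (fun y => k (mul p.1 x, mul p.2 y))).
    rewrite /avg size_map big_map; congr (_ *: _); apply: eq_bigr => p _.
    by rewrite (mean_mull cg p.2 (ck1 _)).
  rewrite -mean_avg; last first.
    by move=> p; apply: (continuous_comp_mull (f := fun y => k (mul p.1 x, y))).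
  apply: (mean_dist_le cg); last by move=> y; apply: (aP (x, y)).
  rewrite /avg => y; apply: cvgZr; apply: continuous_sumf => p.
  exact: (continuous_comp_mull (f := fun y => k (mul p.1 x, y))).
apply: (@mean_near _ _ _ _ _ cg _ _ (map snd a)) => //; first by case: (a) a0.
move=> y.
have -> : avg [seq i.2 | i <- a] (fun y0 => mean mul (fun x => k (x, mul y0 y))) =
    avg a (fun p => mean mul (fun x => k (mul p.1 x, mul p.2 y))).
  rewrite /avg size_map big_map; congr (_ *: _); apply: eq_bigr => p _.
  by rewrite (mean_mull cg p.1 (ck2 _)).
rewrite -mean_avg; last first.
  by move=> p; apply: (continuous_comp_mull (f := fun x => k (x, mul p.2 y))).
apply: (mean_dist_le cg); last by move=> x; apply: (aP (x, y)).
rewrite /avg => x; apply: cvgZr; apply: continuous_sumf => p.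
exact: (continuous_comp_mull (f := fun x => k (x, mul p.2 y))).
Qed.
End ProductGroup.

(** * Convolution on continuous functions *)

Lemma continuous_compose (X Y Z : topologicalType) (f : X -> Y) (g : Y -> Z) :
  continuous f -> continuous g -> continuous (fun x => g (f x)).
Proof. by move=> cf cg x; apply: continuous_comp; [exact: cf | exact: cg]. Qed.

Section L2.
Variables (R : realType) (G : topologicalType).
Variables (mul : G -> G -> G) (inv : G -> G) (e : G).
Hypothesis cg : compact_group mul inv e.

Let mA : forall x y z, mul x (mul y z) = mul (mul x y) z. Proof. by case: cg => -[]. Qed.
Let m1l : forall x, mul e x = x. Proof. by case: cg => -[_ h _] _ x; have [] := h x. Qed.
Let m1r : forall x, mul x e = x. Proof. by case: cg => -[_ h _] _ x; have [] := h x. Qed.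
Let mVl : forall x, mul (inv x) x = e. Proof. by case: cg => -[_ _ h] _ x; have [] := h x. Qed.
Let mVr : forall x, mul x (inv x) = e. Proof. by case: cg => -[_ _ h] _ x; have [] := h x. Qed.
Let cinv : continuous inv. Proof. by case: cg => _ []. Qed.
Let cG : compact [set: G]. Proof. by case: cg => _ []. Qed.

Lemma group_invM x y : inv (mul x y) = mul (inv y) (inv x).
Proof.
rewrite -[RHS]m1r -(mVr (mul x y)) mA -[mul (mul (inv y) _) _]mA.
by rewrite [mul (inv x) (mul x y)]mA mVl m1l mVl m1l.
Qed.

Lemma group_inve : inv e = e. Proof. by rewrite -[LHS]m1l mVr. Qed.

Lemma group_invK x : inv (inv x) = x.
Proof. by rewrite -[LHS]m1r -(mVl x) mA mVl m1l. Qed.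

Implicit Types (f h u : G -> R).

Lemma meanZR (c : R) f : continuous f -> mean mul (fun x => c * f x) = c * mean mul f.
Proof. exact: (meanZ cg). Qed.

(** The values of [f] lie in a ball of centre and radius [c / 2], and the mean stays in that
    ball. *)
Lemma mean_ge0 f : continuous f -> (forall x, 0 <= f x) -> 0 <= mean mul f.
Proof.
move=> cf f0; have [c c0 fc] := compact_bounded_fun cG cf.
have : `|mean mul f - c / 2| <= c / 2.
  apply: (mean_dist_le cg) => // x; have := f0 x; have := fc x.
  by rewrite !ler_norml; lra.
by rewrite ler_norml; lra.
Qed.

Lemma mean_le f h : continuous f -> continuous h -> (forall x, f x <= h x) ->
  mean mul f <= mean mul h.
Proof.
move=> cf ch fh.
have : 0 <= mean mul (fun x => (-1) *: f x + h x).
  apply: mean_ge0; first by move=> x; apply: cvgD; [apply: cvgZr; exact: cf | exact: ch].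
  by move=> x; rewrite scaleN1r addrC subr_ge0.
by rewrite (mean_linear cg) // scaleN1r addrC subr_ge0.
Qed.

(** By compactness finitely many left translates of [f] add up to at least [f g0 / 2] everywhere,
    and all of them have the same mean as [f]. *)
Lemma mean_gt0 f g0 : continuous f -> (forall x, 0 <= f x) -> 0 < f g0 ->
  0 < mean mul f.
Proof.
move=> cf f0 fg0.
have d0 : 0 < f g0 / 2 by rewrite divr_gt0.
have ct t : continuous (fun x => f (mul (mul g0 (inv t)) x)).
  exact: (continuous_comp_mull cg).
have [t|s sP] := @compact_finite_net _ cG (fun t => [set x | f g0 / 2 <= f (mul (mul g0 (inv t)) x)]).
  have /cvgrPdist_le /(_ _ d0) := ct t t; apply: filterS => x /=.
  by rewrite -mA mVl m1r ler_norml; lra.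
have h : f g0 / 2 <= mean mul (fun x => \sum_(t <- s) f (mul (mul g0 (inv t)) x)).
  rewrite -[X in X <= _](mean_cst cg (f g0 / 2 : R)); apply: mean_le.
  - by move=> x; exact: cvg_cst.
  - exact: (@continuous_sumf R R G).
  move=> x; have [t ts /= ht] := sP x; rewrite (big_rem t) //=.
  by apply: (le_trans ht); rewrite lerDl sumr_ge0.
rewrite (mean_sum cg) // in h.
rewrite lt_neqAle mean_ge0 // andbT eq_sym; apply/eqP => mf0.
move: h; rewrite big1; first by rewrite leNgt d0.
by move=> t _; rewrite (@mean_mull _ _ _ _ _ cg R f).
Qed.

Definition l2 f h : R := mean mul (fun g => f g * h g).

Lemma continuousM2 (X : topologicalType) (f h : X -> R) : continuous f -> continuous h ->
  continuous (fun x => f x * h x).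
Proof. by move=> cf ch x; apply: cvgM; [exact: cf | exact: ch]. Qed.

Lemma continuousL (X : topologicalType) (a : R) (f h : X -> R) : continuous f -> continuous h ->
  continuous (fun x => a * f x + h x).
Proof.
move=> cf ch x; apply: cvgD; last exact: ch.
by apply: cvgM; [exact: cvg_cst | exact: cf].
Qed.

Lemma l2_inner : inner_product_on [set f : G -> R | continuous f] l2.
Proof.
split=> /=.
- split; first by move=> x; exact: cvg_cst.
  by move=> a f h cf ch; exact: continuousL.
- by move=> f h _ _; congr mean; apply/funext => x; rewrite mulrC.
- move=> a f h k cf ch ck; rewrite /l2 -[a * _]/(a *: mean mul _).
  have c1 := continuousM2 cf ck; have c2 := continuousM2 ch ck.
  rewrite -(mean_linear cg) //; congr mean.
  apply/funext => x; rewrite [LHS](_ : _ = (a * f x + h x) * k x) //.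
  by rewrite [RHS](_ : _ = a * (f x * k x) + h x * k x) // mulrDl mulrA.
- move=> f cf; apply: mean_ge0; first exact: continuousM2.
  by move=> x; rewrite -expr2 sqr_ge0.
- move=> f cf f0; apply/funext => x; apply: contrapT => fx.
  have : 0 < l2 f f.
    apply: (@mean_gt0 _ x); first exact: continuousM2.
      by move=> y; rewrite -expr2 sqr_ge0.
    by rewrite -expr2 lt_neqAle sqr_ge0 andbT eq_sym sqrf_eq0; apply/eqP.
  by rewrite f0 ltxx.
Qed.

Lemma l2_le f c : continuous f -> 0 <= c -> (forall x, `|f x| <= c) -> l2 f f <= c ^+ 2.
Proof.
move=> cf c0 fc; rewrite -[leRHS](mean_cst cg (c ^+ 2 : R)).
apply: mean_le; first exact: continuousM2.
  by move=> x; exact: cvg_cst.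
by move=> x; rewrite -expr2 -[f x ^+ 2]real_normK ?num_real // lerXn2r ?nnegrE.
Qed.

Section Convolution.
Variable u : G -> R.
Hypothesis cu : continuous u.

(** The [l2] product of [f] with the left translate of [u] by [h]; [convT] is the adjoint, and both
    operators commute with left translations. *)
Definition conv f (h : G) : R := mean mul (fun g => f g * u (mul (inv h) g)).
Definition convT f (h : G) : R := mean mul (fun g => f g * u (mul (inv g) h)).

Let cfst : continuous (fun p : G * G => p.1). Proof. by move=> p; exact: cvg_fst. Qed.
Let csnd : continuous (fun p : G * G => p.2). Proof. by move=> p; exact: cvg_snd. Qed.

Lemma continuous_quotl : continuous (fun p : G * G => u (mul (inv p.1) p.2)).
Proof.
have c : continuous (fun p : G * G => mul (inv p.1) p.2).
  apply: (continuous_mul cg) => //.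
  exact: continuous_compose cfst cinv.
exact: continuous_compose c cu.
Qed.

Lemma continuous_quotr : continuous (fun p : G * G => u (mul (inv p.2) p.1)).
Proof.
have c : continuous (fun p : G * G => mul (inv p.2) p.1).
  apply: (continuous_mul cg) => //.
  exact: continuous_compose csnd cinv.
exact: continuous_compose c cu.
Qed.

Let cf2 f : continuous f -> continuous (fun p : G * G => f p.2).
Proof. by move=> cf; exact: continuous_compose csnd cf. Qed.

Lemma continuous_quotl1 (h : G) : continuous (fun g => u (mul (inv h) g)).
Proof.
exact: (continuous_section1 (k := fun p => u (mul (inv p.1) p.2)) continuous_quotl).
Qed.

Lemma continuous_quotr1 (h : G) : continuous (fun g => u (mul (inv g) h)).
Proof.
exact: (continuous_section2 (k := fun p => u (mul (inv p.1) p.2)) continuous_quotl).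
Qed.

Let cu1 := continuous_quotl.
Let cu2 := continuous_quotr.
Let cul := continuous_quotl1.
Let cur := continuous_quotr1.

Lemma continuous_conv f : continuous f -> continuous (conv f).
Proof.
move=> cf; apply: (continuous_mean cg (k := fun p => f p.2 * u (mul (inv p.1) p.2))).
by apply: continuousM2 => //; exact: cf2.
Qed.

Lemma continuous_convT f : continuous f -> continuous (convT f).
Proof.
move=> cf; apply: (continuous_mean cg (k := fun p => f p.2 * u (mul (inv p.2) p.1))).
by apply: continuousM2 => //; exact: cf2.
Qed.

Lemma conv_adjoint f h : continuous f -> continuous h ->
  l2 (conv f) h = l2 f (convT h).
Proof.
move=> cf ch; rewrite /l2 /conv /convT.
pose k (p : G * G) : R := f p.2 * u (mul (inv p.1) p.2) * h p.1.
have ck : continuous k.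
  apply: continuousM2; first by apply: continuousM2 => //; exact: cf2.
  exact: continuous_compose cfst ch.
transitivity (mean mul (fun x => mean mul (fun y => k (x, y)))).
  congr mean; apply/funext => x; rewrite mulrC -meanZR; last exact: continuousM2.
  by congr mean; apply/funext => y; rewrite /k /= mulrC.
rewrite (mean_fubini cg ck); congr mean; apply/funext => y.
rewrite -meanZR; last exact: continuousM2.
by congr mean; apply/funext => x; rewrite /k /=; ring.
Qed.

Lemma conv_linear (a : R) f h : continuous f -> continuous h ->
  conv (a *: f + h) = a *: conv f + conv h.
Proof.
move=> cf ch; apply/funext => x.
rewrite /conv [RHS](_ : _ = a *: mean mul (fun g => f g * u (mul (inv x) g)) +
  mean mul (fun g => h g * u (mul (inv x) g))) //.
rewrite -(mean_linear cg); try exact: continuousM2.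
congr mean; apply/funext => g.
rewrite [LHS](_ : _ = (a * f g + h g) * u (mul (inv x) g)) //.
by rewrite [RHS](_ : _ = a * (f g * u (mul (inv x) g)) + h g * u (mul (inv x) g)) // mulrDl mulrA.
Qed.

Lemma convT_linear (a : R) f h : continuous f -> continuous h ->
  convT (a *: f + h) = a *: convT f + convT h.
Proof.
move=> cf ch; apply/funext => x.
rewrite /convT [RHS](_ : _ = a *: mean mul (fun g => f g * u (mul (inv g) x)) +
  mean mul (fun g => h g * u (mul (inv g) x))) //.
rewrite -(mean_linear cg); try exact: continuousM2.
congr mean; apply/funext => g.
rewrite [LHS](_ : _ = (a * f g + h g) * u (mul (inv g) x)) //.
by rewrite [RHS](_ : _ = a * (f g * u (mul (inv g) x)) + h g * u (mul (inv g) x)) // mulrDl mulrA.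
Qed.

Lemma conv_transl f k : continuous f ->
  conv (fun g => f (mul (inv k) g)) = fun h : G => conv f (mul (inv k) h).
Proof.
move=> cf; apply/funext => h; rewrite /conv.
rewrite -(mean_mull cg k); last first.
  by apply: continuousM2 => //; exact: (continuous_comp_mull cg).
by congr mean; apply/funext => g; rewrite mA mVl m1l group_invM group_invK mA.
Qed.

Lemma convT_transl f k : continuous f ->
  convT (fun g => f (mul (inv k) g)) = fun h : G => convT f (mul (inv k) h).
Proof.
move=> cf; apply/funext => h; rewrite /convT.
rewrite -(mean_mull cg k); last first.
  by apply: continuousM2 => //; exact: (continuous_comp_mull cg).
by congr mean; apply/funext => g; rewrite mA mVl m1l group_invM mA.
Qed.

Variable c : R.
Hypotheses (c0 : 0 <= c) (uc : forall x, `|u x| <= c).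

Let CS := @ip_cauchy_schwarz R (G -> R) _ _ l2_inner.

Lemma conv_sq f (h : G) : continuous f -> conv f h ^+ 2 <= l2 f f * c ^+ 2.
Proof.
move=> cf; pose w g := u (mul (inv h) g).
have /le_trans : conv f h ^+ 2 <= l2 f f * l2 w w := CS cf (@continuous_quotl1 h); apply.
apply: ler_wpM2l; first by apply: mean_ge0; [exact: continuousM2 | move=> x; rewrite -expr2 sqr_ge0].
by apply: l2_le => // [|x]; [exact: (@continuous_quotl1 h) | exact: uc].
Qed.

Lemma convT_sq f (h : G) : continuous f -> convT f h ^+ 2 <= l2 f f * c ^+ 2.
Proof.
move=> cf; pose w g := u (mul (inv g) h).
have /le_trans : convT f h ^+ 2 <= l2 f f * l2 w w := CS cf (@continuous_quotr1 h); apply.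
apply: ler_wpM2l; first by apply: mean_ge0; [exact: continuousM2 | move=> x; rewrite -expr2 sqr_ge0].
by apply: l2_le => // [|x]; [exact: (@continuous_quotr1 h) | exact: uc].
Qed.

Lemma l2_sq_le f (d : R) : continuous f -> (forall x, f x ^+ 2 <= d) -> l2 f f <= d.
Proof.
move=> cf fd; rewrite -[leRHS](mean_cst cg (d : R)).
apply: mean_le; first exact: continuousM2.
  by move=> x; exact: cvg_cst.
by move=> x; rewrite -expr2.
Qed.

End Convolution.
End L2.

(** * Finite-dimensional spaces of coefficients *)

Section PeterWeyl.
Variables (R : realType) (G : topologicalType).
Variables (mul : G -> G -> G) (inv : G -> G) (e : G).
Hypothesis cg : compact_group mul inv e.
Variable u : G -> R.
Hypothesis cu : continuous u.

Let cG : compact [set: G]. Proof. by case: cg => _ []. Qed.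
Let B := conv mul inv u.
Let BT := convT mul inv u.
Let A f := BT (B f).
Let ip := l2 mul (R := R).

Let cB f : continuous f -> continuous (B f). Proof. exact: (continuous_conv cg). Qed.
Let cBT f : continuous f -> continuous (BT f). Proof. exact: (continuous_convT cg). Qed.
Let cA f : continuous f -> continuous (A f). Proof. by move=> cf; apply: cBT; apply: cB. Qed.
Let ipC f h : ip f h = ip h f.
Proof. by rewrite /ip /l2; congr mean; apply/funext => x; rewrite mulrC. Qed.

Let AL (a : R) f h : continuous f -> continuous h -> A (a *: f + h) = a *: A f + A h.
Proof.
move=> cf ch; rewrite /A /B (conv_linear cg cu) // /BT (convT_linear cg cu) //; exact: cB.
Qed.

Let AE f h : continuous f -> continuous h -> ip (A f) h = ip (B f) (B h).
Proof.
move=> cf ch; rewrite ipC /A /ip /BT -(conv_adjoint cg) //; exact: cB.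
Qed.

(** [ip (A f) h = ip (B f) (B h)] makes [A] symmetric and positive; it is compact by Ascoli's
    theorem, as its images of the unit ball are uniformly bounded and equicontinuous. *)
Lemma conv_eigenvector : (exists g, u g <> 0) ->
  exists (lam : R) v, [/\ 0 < lam, continuous v, v <> 0 & A v = lam *: v].
Proof.
move=> [g0 u0].
have [c c0 uc] := compact_bounded_fun cG cu.
have ipB f : continuous f -> ip (B f) (B f) <= ip f f * c ^+ 2.
  move=> cf; apply: (l2_sq_le cg); first exact: cB.
  by move=> x; exact: (conv_sq cg).
have ip0 f : continuous f -> 0 <= ip f f.
  by move=> cf; have [_ _ _ h _] := l2_inner R cg; exact: h.
apply: (compact_positive_eigenvector (l2_inner R cg) (A := A)) => //=.
- by move=> f h cf ch; rewrite -/ip AE // [RHS]ipC AE // ipC.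
- by move=> f cf; rewrite -/ip AE //; apply: ip0; exact: cB.
- by exists (c ^+ 2) => f cf; rewrite -/ip AE // mulrC; exact: ipB.
- move=> f fP.
  have cf n : continuous (f n) by have [] := fP n.
  have f1 n : ip (f n) (f n) <= 1 by have [] := fP n.
  have Bf1 n : ip (B (f n)) (B (f n)) <= c ^+ 2.
    by apply: le_trans (ipB _ (cf n)) _; rewrite ler_piMl // sqr_ge0.
  have [||v cv vP] := @equicontinuous_cluster _ _ (fun n => A (f n)) (c ^+ 2) cG.
  + move=> n h.
    have k : A (f n) h ^+ 2 <= ip (B (f n)) (B (f n)) * c ^+ 2.
      exact: (convT_sq cg cu c0 uc h (cB (cf n))).
    have {k} : `|A (f n) h| ^+ 2 <= (c ^+ 2) ^+ 2.
      rewrite real_normK ?num_real //; apply: le_trans k _.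
      by rewrite [leRHS]expr2; apply: ler_wpM2r; rewrite ?sqr_ge0.
    by rewrite ler_sqr ?nnegrE ?sqr_ge0.
  (* By Cauchy-Schwarz the variation of [A (f n)] is at most [c] times that of the translates of
     [u], uniformly in [n]. *)
  + move=> h eps e0.
    have c1 : 0 < c + 1 by rewrite ltr_wpDl.
    pose d := eps / (c + 1).
    have d0 : 0 < d by rewrite divr_gt0.
    have := compact_tube cG (continuous_quotr cg cu) h d0.
    apply: filterS => h' hh n.
    have cq x : continuous (fun g => u (mul (inv g) x)) by exact: (continuous_quotr1 cg cu).
    pose q g := (-1) * u (mul (inv g) h) + u (mul (inv g) h').
    have cq2 : continuous q by apply: continuousL; exact: cq.
    have -> : A (f n) h' - A (f n) h = ip (B (f n)) q.
      rewrite /A /BT /convT addrC -scaleN1r -(mean_linear cg).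
      * rewrite /ip /l2; congr mean; apply/funext => g; rewrite /q mulrDr.
        by congr (_ + _); rewrite mulrCA.
      * by apply: continuousM2; [exact: cB | exact: cq].
      * by apply: continuousM2; [exact: cB | exact: cq].
    have k : ip (B (f n)) q ^+ 2 <= ip (B (f n)) (B (f n)) * ip q q.
      by apply: (ip_cauchy_schwarz (l2_inner R cg)) => //=; exact: cB.
    have qd : ip q q <= d ^+ 2.
      apply: (l2_le cg) => // [|g]; first exact: ltW.
      by rewrite /q mulN1r addrC; exact: hh.
    have {k} : `|ip (B (f n)) q| ^+ 2 <= (c * d) ^+ 2.
      rewrite real_normK ?num_real // exprMn; apply: le_trans k _.
      by apply: ler_pM => //; apply: ip0 => //; exact: cB.
    have cd0 : 0 <= c * d by apply: mulr_ge0 => //; exact: ltW.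
    rewrite ler_sqr ?nnegrE // => /le_trans; apply.
    rewrite /d mulrCA; apply: ler_piMr; first exact: ltW.
    by rewrite ler_pdivrMr // mul1r lerDl.
  exists v => // eps n0 e0.
  have s0 : 0 < Num.sqrt eps by rewrite sqrtr_gt0.
  have [n nn0 nP] := vP _ n0 s0; exists n => //.
  rewrite -[leRHS](sqr_sqrtr (ltW e0)); apply: (l2_le cg); rewrite ?(ltW s0) //.
  move=> x; apply: cvgB; [exact: cA | exact: cv].
(* The form at [u] is the squared norm of [B u], a function whose value at [e] is [ip u u]. *)
- exists u => //; rewrite -/ip AE //.
  apply: (mean_gt0 cg (g0 := e)).
  + by apply: continuousM2; exact: cB.
  + by move=> x; rewrite -expr2 sqr_ge0.
  rewrite -expr2 exprn_even_gt0 //=.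
  have : 0 < B u e.
    have -> : B u e = ip u u.
      rewrite /B /conv /ip /l2; congr mean; apply/funext => g.
      have [[_ m1 _] _] := cg.
      by rewrite (group_inve cg) (m1 g).1.
    apply: (mean_gt0 cg (g0 := g0)).
    + exact: continuousM2.
    + by move=> x; rewrite -expr2 sqr_ge0.
    + by rewrite -expr2 exprn_even_gt0 //=; apply/eqP.
  by move=> /gt_eqF ->.
Qed.

Lemma fct_sum_scaleE (T I : Type) (r : seq I) (a : I -> R) (b : I -> T -> R) x :
  (\sum_(i <- r) a i *: (b i : T -> R)) x = \sum_(i <- r) a i * b i x.
Proof.
elim: r => [|i r IH]; first by rewrite !big_nil.
by rewrite !big_cons -IH.
Qed.

(** Evaluating [A (b i)] at [h] is pairing [b i] with [BT w], where [w] depends on [h] only.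
    Bessel's inequality then bounds the sum of the [(lam * b i h) ^+ 2] by [c ^+ 4], and averaging
    over [h] gives [n * lam ^+ 2 <= c ^+ 4]. *)
Lemma eigenspace_dim_bound (lam : R) : 0 < lam -> exists m : nat,
  forall n (b : 'I_n -> G -> R), (forall i, continuous (b i) /\ A (b i) = lam *: b i) ->
    orthonormal_fam ip b -> (n <= m)%N.
Proof.
move=> lam0; have [c c0 uc] := compact_bounded_fun cG cu.
exists (Num.bound (c ^+ 4 / lam ^+ 2)) => n b bE ob.
have cb i : continuous (b i) by have [] := bE i.
have ptw h : \sum_i (lam * b i h) * (lam * b i h) <= c ^+ 4.
  pose w g := u (mul (inv g) h).
  have cw : continuous w by exact: (continuous_quotr1 cg cu).
  have cBw := cBT cw.
  have bE' i : lam * b i h = ip (BT w) (b i).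
    rewrite ipC /ip /BT -(conv_adjoint cg) //.
    by have [_ /(congr1 (fun f : G -> R => f h))] := bE i.
  have := ip_bessel (l2_inner R cg) cb ob cBw.
  rewrite -/ip => /le_trans h1; under eq_bigr do rewrite !bE' -expr2.
  apply: h1; apply: (l2_sq_le cg) => // x.
  apply: le_trans (convT_sq cg cu c0 uc _ cw) _.
  have -> : c ^+ 4 = c ^+ 2 * c ^+ 2 by ring.
  by apply: ler_wpM2r; [exact: sqr_ge0 | apply: (l2_le cg) => // g; exact: uc].
have cl i : continuous (fun h => lam * b i h * (lam * b i h)).
  have h1 : continuous (fun h => lam * b i h).
    by move=> x; apply: cvgM; [exact: cvg_cst | exact: cb].
  exact: continuousM2.
have : n%:R * lam ^+ 2 <= c ^+ 4.
  rewrite -[leRHS](mean_cst cg (c ^+ 4 : R)).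
  have <- : mean mul (fun h => \sum_i (lam * b i h) * (lam * b i h)) = n%:R * lam ^+ 2.
    rewrite (@mean_sum _ _ _ _ _ cg R _ _ (fun i h => lam * b i h * (lam * b i h))) //.
    rewrite -[n in RHS]card_ord -mulr_natl mulr1 mulr_natl -sumr_const.
    apply: eq_bigr => i _.
    have -> : (fun h => lam * b i h * (lam * b i h)) = fun h => lam ^+ 2 * (b i h * b i h).
      by apply/funext => h; ring.
    rewrite (meanZR cg); last exact: continuousM2.
    by have := ob i i; rewrite eqxx /ip /l2 => ->; rewrite mulr1.
  apply: (mean_le cg) => //; first exact: (@continuous_sumf R R G).
  by move=> x; exact: cvg_cst.
have l2 : 0 < lam ^+ 2 by rewrite exprn_gt0.
rewrite -ler_pdivlMr // => /le_lt_trans h.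
have /h : c ^+ 4 / lam ^+ 2 < (Num.bound (c ^+ 4 / lam ^+ 2))%:R.
  by apply: archi_boundP; rewrite divr_ge0 ?exprn_ge0 // ltW.
by rewrite ltr_nat => /ltnW.
Qed.

(** [b] is an orthonormal basis of an eigenspace of [A], and [rho] is left translation written in
    this basis. *)
Lemma finite_dim_coefficients : (exists g, u g <> 0) ->
  exists n (b : 'I_n -> G -> R) (rho : G -> 'M[R]_n),
  [/\ (forall i, continuous (b i)), real_rep mul e rho,
      (forall k j g, b j (mul (inv k) g) = \sum_i rho k i j * b i g) &
      exists j, mean mul (fun g => b j g * u g) <> 0].
Proof.
move=> u0; have [lam [v [lam0 cv vN vE]]] := conv_eigenvector u0.
have [m bm] := eigenspace_dim_bound lam0.
pose E : set (G -> R) := [set f | continuous f /\ A f = lam *: f].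
have EC : E `<=` [set f | continuous f] by move=> f [].
have EL (a : R) f h : E f -> E h -> E (a *: f + h).
  move=> [cf fE] [ch hE]; split; first exact: continuousL.
  by rewrite AL // fE hE scalerDr !scalerA mulrC.
have ET k f : E f -> E (fun g => f (mul (inv k) g)).
  move=> [cf fE]; split; first exact: (continuous_comp_mull cg).
  rewrite /A /B (conv_transl cg cu) // /BT (convT_transl cg cu) //; last exact: cB.
  by rewrite -/BT -/B -[BT (B f)]/(A f) fE.
have [n [b [bE ob bspan]]] := finite_orthonormal_basis (l2_inner R cg) EC EL bm.
have cb i : continuous (b i) by have [] := bE i.
have [[mA m1 mV] _] := cg.
pose rho k : 'M[R]_n := \matrix_(i, j) ip (fun g => b j (mul (inv k) g)) (b i).
have bT k j g : b j (mul (inv k) g) = \sum_i rho k i j * b i g.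
  have := bspan _ (ET k _ (bE j)) => /(congr1 (fun f : G -> R => f g)) ->.
  by rewrite fct_sum_scaleE; apply: eq_bigr => i _; rewrite mxE.
have coord (c : 'I_n -> R) j f : (forall g, f g = \sum_i c i * b i g) -> ip f (b j) = c j.
  move=> fE; rewrite -[RHS](ip_orthonormal_sum (l2_inner R cg) c j cb ob).
  by congr ip; apply/funext => g; rewrite fct_sum_scaleE.
exists n, b, rho; split=> //.
- split.
  + apply/matrixP => i j; rewrite !mxE -(ob i j) ipC; congr ip.
    by apply/funext => g; rewrite (group_inve cg) (m1 g).1.
  + move=> k l; apply/matrixP => i j; rewrite !mxE.
    under eq_bigr do rewrite mulrC.
    apply: (coord (fun i => \sum_q rho l q j * rho k i q)) => g.
    rewrite (group_invM cg) -mA bT.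
    under eq_bigr do rewrite bT mulr_sumr.
    rewrite exchange_big /=; apply: eq_bigr => q _.
    by rewrite mulr_suml; apply: eq_bigr => r _; rewrite mulrA.
  + move=> i j.
    rewrite (_ : (fun k => _) = fun k => ip (fun g => b j (mul (inv k) g)) (b i)); last first.
      by apply/funext => k; rewrite mxE.
    apply: (continuous_mean cg (k := fun p => b j (mul (inv p.1) p.2) * b i p.2)).
    apply: continuousM2; first exact: (continuous_quotl cg).
    by move=> p; apply: (@continuous_comp _ _ _ snd (b i)); [exact: cvg_snd | exact: cb].
- apply: contrapT => nb.
  have bu j : mean mul (fun g => b j g * u g) = 0.
    by apply: contrapT => h; apply: nb; exists j.
  (* Moving the translation from [u] to [b j] shows that the values of [B (b j)] are combinations of
     the products of the [b i] with [u], all of which vanish; then [A (b j) = 0], against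
     [lam > 0]. *)
  have Bb j : B (b j) = 0.
    apply/funext => h; rewrite /B /conv -(mean_mull cg h); last first.
      by apply: continuousM2; [exact: cb | exact: (continuous_quotl1 cg cu)].
    have -> : (fun g => b j (mul h g) * u (mul (inv h) (mul h g))) =
        fun g => \sum_i rho (inv h) i j * (b i g * u g).
      apply/funext => g; rewrite mA (mV h).1 (m1 g).1 -{1}(group_invK cg h) bT mulr_suml.
      by apply: eq_bigr => i _; rewrite mulrA.
    rewrite (@mean_sum _ _ _ _ _ cg R _ _ (fun i g => rho (inv h) i j * (b i g * u g))).
      rewrite big1 // => i _; rewrite (meanZR cg) ?bu ?mulr0 //.
      exact: continuousM2.
    move=> i x; apply: cvgM; first exact: cvg_cst.
    exact: (continuousM2 (cb i) cu).
  apply: vN; rewrite (bspan v); last by split.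
  apply: big1 => j _; have [_ bjE] := bE j.
  have A0 : A (b j) = 0.
    rewrite /A Bb; apply/funext => h; rewrite -[RHS](mean_cst cg (0 : R)).
    by rewrite /BT /convT; congr mean; apply/funext => g; rewrite [LHS]mul0r.
  have : b j = 0.
    have := congr1 (fun f => lam^-1 *: f) bjE.
    by rewrite A0 scaler0 scalerA mulVf ?gt_eqF // scale1r.
  by move=> ->; rewrite scaler0.
Qed.

End PeterWeyl.

(** * Finite-dimensional representations *)

Section MatrixMean.
Variables (R : realType) (G : topologicalType).
Variables (mul : G -> G -> G) (inv : G -> G) (e : G).
Hypothesis cg : compact_group mul inv e.

Definition mxcontinuous m n (F : G -> 'M[R]_(m, n)) :=
  forall i j, continuous (fun g => F g i j).

Definition mxmean m n (F : G -> 'M[R]_(m, n)) : 'M[R]_(m, n) :=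
  \matrix_(i, j) mean mul (fun g => F g i j).

Lemma mxcontinuous_mul m n p (F : G -> 'M[R]_(m, n)) (F' : G -> 'M[R]_(n, p)) :
  mxcontinuous F -> mxcontinuous F' -> mxcontinuous (fun g => F g *m F' g).
Proof.
move=> cF cF' i j.
rewrite (_ : (fun _ => _) = fun g => \sum_k F g i k * F' g k j); last first.
  by apply/funext => g; rewrite mxE.
by apply: (@continuous_sumf R R G) => k; exact: continuousM2.
Qed.

Lemma mxcontinuous_cst m n (A : 'M[R]_(m, n)) : mxcontinuous (fun=> A).
Proof. by move=> i j x; exact: cvg_cst. Qed.

Lemma mxmean_cst m n (A : 'M[R]_(m, n)) : mxmean (fun=> A) = A.
Proof. by apply/matrixP => i j; rewrite mxE (mean_cst cg). Qed.

Lemma mxmean_mull m n p (A : 'M[R]_(p, m)) (F : G -> 'M[R]_(m, n)) :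
  mxcontinuous F -> mxmean (fun g => A *m F g) = A *m mxmean F.
Proof.
move=> cF; apply/matrixP => i j; rewrite !mxE.
rewrite (_ : (fun _ => _) = fun g => \sum_k A i k * F g k j); last first.
  by apply/funext => g; rewrite mxE.
rewrite (@mean_sum _ _ _ _ _ cg R _ _ (fun k g => A i k * F g k j)); last first.
  by move=> k; apply: continuousM2; [move=> x; exact: cvg_cst | exact: cF].
by apply: eq_bigr => k _; rewrite (meanZR cg) ?mxE.
Qed.

Lemma mxmean_tr m n (F : G -> 'M[R]_(m, n)) :
  mxmean (fun g => (F g)^T) = (mxmean F)^T.
Proof.
by apply/matrixP => i j; rewrite !mxE; congr mean; apply/funext => g; rewrite mxE.
Qed.

Lemma mxmean_mulr m n p (A : 'M[R]_(n, p)) (F : G -> 'M[R]_(m, n)) :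
  mxcontinuous F -> mxmean (fun g => F g *m A) = mxmean F *m A.
Proof.
move=> cF; apply: trmx_inj; rewrite trmx_mul -!mxmean_tr -mxmean_mull.
  by congr mxmean; apply/funext => g; rewrite trmx_mul.
by move=> i j; rewrite (_ : (fun _ => _) = fun g => F g j i) //; apply/funext => g; rewrite mxE.
Qed.

Lemma mxmean_trace n (F : G -> 'M[R]_n) : mxcontinuous F ->
  \tr (mxmean F) = mean mul (fun g => \tr (F g)).
Proof.
move=> cF; rewrite /mxtrace (@mean_sum _ _ _ _ _ cg R _ _ (fun i g => F g i i)) //.
by apply: eq_bigr => i _; rewrite mxE.
Qed.

Variables (n : nat) (rho : G -> 'M[R]_n).
Hypothesis rrho : real_rep mul e rho.

(** The projection of [p] onto the commutant of [rho]; it preserves the trace. *)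
Definition conj_mean (p : 'M[R]_n) := mxmean (fun g => rho g *m p *m rho (inv g)).

Lemma continuous_rep_inv : mxcontinuous (fun g => rho (inv g)).
Proof.
have [_ _ crho] := rrho; have [_ [_ cinv _ _]] := cg => i j.
exact: (continuous_compose cinv (crho i j)).
Qed.

Lemma continuous_conj p : mxcontinuous (fun g => rho g *m p *m rho (inv g)).
Proof.
have [_ _ crho] := rrho; apply: mxcontinuous_mul; last exact: continuous_rep_inv.
by apply: mxcontinuous_mul => //; exact: mxcontinuous_cst.
Qed.

Lemma rep_invK g : rho (inv g) *m rho g = 1%:M.
Proof.
have [r1 rM _] := rrho; have [[_ _ mV] _] := cg.
by rewrite -rM (mV g).1.
Qed.

Lemma rep_Kinv g : rho g *m rho (inv g) = 1%:M.
Proof.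
have [r1 rM _] := rrho; have [[_ _ mV] _] := cg.
by rewrite -rM (mV g).2.
Qed.

Lemma conj_mean_comm p h : rho h *m conj_mean p = conj_mean p *m rho h.
Proof.
have [r1 rM _] := rrho; have cc := @continuous_conj p.
suff E : rho h *m conj_mean p *m rho (inv h) = conj_mean p.
  by rewrite -{2}E -mulmxA rep_invK mulmx1.
rewrite /conj_mean -mxmean_mull // -mxmean_mulr; last first.
  by apply: mxcontinuous_mul => //; exact: mxcontinuous_cst.
apply/matrixP => i j; rewrite !mxE -[RHS](mean_mull cg h); last exact: cc.
congr mean; apply/funext => g.
by rewrite (group_invM cg) !rM !mulmxA.
Qed.

Lemma conj_mean_trace p : \tr (conj_mean p) = \tr p.
Proof.
rewrite mxmean_trace; last exact: continuous_conj.
rewrite -[RHS](mean_cst cg (\tr p : R)); congr mean; apply/funext => g.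
by rewrite mxtrace_mulC mulmxA rep_invK mul1mx.
Qed.

End MatrixMean.

(** * Linear subspaces of column vectors as row spaces *)

Section Subspace.
Variables (R : realType) (n : nat) (S : set 'cV[R]_n).
Hypotheses (S0 : S 0) (SL : forall (a : R) v w, S v -> S w -> S (a *: v + w)).

(** Among the matrices whose rows lie in [S], take one of maximal rank: adjoining a further vector
    of [S] cannot enlarge its row space. *)
Lemma subspace_rowspace : exists M : 'M[R]_n, forall v, S v <-> (v^T <= M)%MS.
Proof.
pose P (r : nat) := `[< exists M : 'M[R]_n, (forall v, (v^T <= M)%MS -> S v) /\ \rank M = r >].
have P0 : exists r, P r.
  exists 0%N; apply/asboolP; exists 0; rewrite mxrank0; split => // v.
  by rewrite submx0 trmx_eq0 => /eqP->.
have Pn r : P r -> (r <= n)%N by move=> /asboolP[M [_ <-]]; exact: rank_leq_row.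
case: (ex_maxnP P0 Pn) => r /asboolP[M [MS rM]] rmax; exists M => v.
split; last exact: MS.
move=> Sv; have : P (\rank (v^T + M)%MS).
  apply/asboolP; exists (v^T + M)%MS; split=> // w /sub_addsmxP[[a b] /= wE].
  have -> : w = a 0 0 *: v + (b *m M)^T.
    apply: trmx_inj; rewrite wE [a]mx11_scalar mul_scalar_mx linearD /= linearZ /= trmxK.
    by rewrite mxE mulr1n.
  by apply: SL => //; apply: MS; rewrite trmxK submxMl.
move=> /rmax; rewrite -rM (geq_leqif (mxrank_leqif_sup (addsmxSr v^T M))).
by apply: submx_trans; exact: addsmxSl.
Qed.

(** [Z] expresses membership in [S] by linear equations, a form that passes through entrywise
    means. *)
Lemma subspace_projection : exists (p : 'M[R]_n) (Z : 'M[R]_n),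
  [/\ (forall v, S v <-> Z *m v = 0), (forall v, S (p *m v)) &
      (forall v, S v -> p *m v = v)].
Proof.
have [M MP] := subspace_rowspace.
exists (proj_mx M M^C%MS)^T, (cokermx M)^T; split.
- move=> v; split.
    by move=> /MP; rewrite submxE => /eqP h; apply: trmx_inj; rewrite trmx_mul trmxK h trmx0.
  move=> h; apply/MP; rewrite submxE; apply/eqP; apply: trmx_inj.
  by rewrite trmx_mul trmxK h trmx0.
- by move=> v; apply/MP; rewrite trmx_mul trmxK proj_mx_sub.
- move=> v /MP vM; apply: trmx_inj; rewrite trmx_mul trmxK proj_mx_id //.
  exact: capmx_compl.
Qed.
End Subspace.

(** * Detecting operators on irreducible subrepresentations *)

(** The full-rank factorisation [q = C B]; cancelling the one-sided inverses of [C] and [B] in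
    [C B C B = C B] leaves [B C = 1]. *)
Lemma idempotent_factor (F : fieldType) n (q : 'M[F]_n) : q *m q = q ->
  exists (C : 'M[F]_(n, \rank q)) (B : 'M[F]_(\rank q, n)), C *m B = q /\ B *m C = 1%:M.
Proof.
move=> qq; exists (col_base q), (row_base q); have CB := mulmx_base q.
move: CB (mulVpmx (col_base_full q)) (mulmxVp (row_base_free q)).
move: (pinvmx _) (pinvmx _) => B' C'; move: (col_base q) (row_base q) => C B CB CC BB.
split=> //; have : C' *m (C *m B *m (C *m B)) *m B' = C' *m (C *m B) *m B' by rewrite CB qq.
by rewrite !mulmxA CC mul1mx -!mulmxA BB !mulmx1.
Qed.

Section LinearMap.
Variables (R : realType) (W : normedModType R).

Lemma linear_map0 (f : W -> W) : is_linear_map f -> f 0 = 0.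
Proof. by move=> fl; have := fl (-1) 0 0; rewrite scaler0 add0r scaleN1r addNr. Qed.

Lemma linear_mapB (f : W -> W) x y : is_linear_map f -> f (x - y) = f x - f y.
Proof. by move=> fl; rewrite addrC -scaleN1r fl scaleN1r addrC. Qed.

Lemma linear_map_sum (I : Type) (r : seq I) (f : W -> W) (c : I -> R) (x : I -> W) :
  is_linear_map f -> f (\sum_(i <- r) c i *: x i) = \sum_(i <- r) c i *: f (x i).
Proof.
move=> fl; elim: r => [|i r IH]; first by rewrite !big_nil linear_map0.
by rewrite !big_cons fl IH.
Qed.

End LinearMap.

Section Rep.
Variables (R : realType) (W : completeNormedModType R) (G : topologicalType).
Variables (mul : G -> G -> G) (inv : G -> G) (e : G) (alpha : G -> W -> W).
Hypothesis cg : compact_group mul inv e.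
Hypothesis rep : isometric_rep mul e alpha.

Let mA : forall x y z, mul x (mul y z) = mul (mul x y) z. Proof. by case: cg => -[]. Qed.
Let m1l : forall x, mul e x = x. Proof. by case: cg => -[_ h _] _ x; have [] := h x. Qed.
Let mVl : forall x, mul (inv x) x = e. Proof. by case: cg => -[_ _ h] _ x; have [] := h x. Qed.
Let mVr : forall x, mul x (inv x) = e. Proof. by case: cg => -[_ _ h] _ x; have [] := h x. Qed.
Let aL : forall g, is_linear_map (alpha g). Proof. by case: rep. Qed.
Let a1 : forall x, alpha e x = x. Proof. by case: rep. Qed.
Let aM : forall g h x, alpha (mul g h) x = alpha g (alpha h x). Proof. by case: rep. Qed.
Let aN : forall g x, `|alpha g x| = `|x|. Proof. by case: rep. Qed.
Let aC : forall x, continuous (fun g => alpha g x). Proof. by case: rep. Qed.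

Lemma rep_Kinv_act g x : alpha g (alpha (inv g) x) = x.
Proof. by rewrite -aM mVr a1. Qed.

Lemma rep_invK_act g x : alpha (inv g) (alpha g x) = x.
Proof. by rewrite -aM mVl a1. Qed.

Lemma continuous_act (F : G -> W) : continuous F -> continuous (fun g => alpha g (F g)).
Proof.
move=> cF g; apply/cvgrPdist_le => eps e0.
have e2 : 0 < eps / 2 by rewrite divr_gt0.
have /cvgrPdist_le /(_ _ e2) h1 := cF g.
have /cvgrPdist_le /(_ _ e2) h2 := @aC (F g) g.
near=> g'.
rewrite [eps]splitr -(subrKA (alpha g' (F g))); apply: le_trans (ler_normD _ _) _.
apply: lerD; first by near: g'.
by rewrite -linear_mapB // aN; near: g'.
Unshelve. all: by end_near. Qed.

Lemma mean_act k (F : G -> W) : continuous F ->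
  alpha k (mean mul F) = mean mul (fun g => alpha k (F g)).
Proof.
move=> cF; have [|_ -> //] := mean_linear_comp cg (@aL k) (c := 1) _ cF.
by move=> x; rewrite mul1r aN.
Qed.

(** An intertwiner that may have a kernel, unlike an [intertwining_embedding]. *)
Definition equivariant_map n (rho : G -> 'M[R]_n) (T : 'cV[R]_n -> W) :=
  (forall (a : R) v w, T (a *: v + w) = a *: T v + T w) /\
  (forall g v, alpha g (T v) = T (rho g *m v)).

(** Schur's lemma: the kernel is an invariant subspace. *)
Lemma equivariant_injective n (rho : G -> 'M[R]_n) T v0 :
  irreducible_real_rep mul e rho -> equivariant_map rho T -> T v0 <> 0 -> injective T.
Proof.
move=> [_ _ irrS] [TL Teq] Tv0 v w Tvw.
have [||g v' Tv'|kE|kE] := irrS [set v | T v = 0].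
- by have := TL (-1) 0 0; rewrite /= scaler0 add0r scaleN1r addNr.
- by move=> a x y /= Tx Ty; rewrite TL Tx Ty scaler0 addr0.
- by rewrite /= -Teq (_ : T v' = 0) // linear_map0.
- have : [set v | T v = 0] (v - w).
    by rewrite /= addrC -scaleN1r TL scaleN1r Tvw addNr.
  by rewrite kE => /= /eqP; rewrite subr_eq0 => /eqP.
- by have : [set v | T v = 0] v0 by rewrite kE.
Qed.

Section Detect.
Variable D : W -> W.
Hypothesis bD : is_bounded_linear D.

(** The vectors [psi j], the means of [b j g *: alpha g x0], are permuted linearly by [rho], and
    [l (D (psi j))] is the [l2] product of [b j] with [u], which is nonzero for some [j]. *)
Lemma finite_dim_detects x0 : D x0 <> 0 ->
  exists n (rho : G -> 'M[R]_n) T,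
    [/\ real_rep mul e rho, equivariant_map rho T & exists v, D (T v) <> 0].
Proof.
move=> Dx0; have [l [lL lb lN]] := norming_functional Dx0.
have [DL [c Dc]] := bD.
pose L x : R := l (D x).
have LL (a : R) x y : L (a *: x + y) = a *: L x + L y by rewrite /L DL lL.
have Lb x : `|L x| <= c * `|x| by apply: le_trans (lb _) _.
pose u g := L (alpha g x0).
have [cu _] := mean_linear_comp cg LL Lb (@aC x0).
have [|n [b [rho [cb rrho bT [j0 bj0]]]]] := finite_dim_coefficients cg (u := u) cu.
  by exists e; rewrite /u a1.
pose psi j := mean mul (fun g => b j g *: alpha g x0).
have cpsi j : continuous (fun g => b j g *: alpha g x0).
  by move=> g; apply: cvgZ; [exact: cb | exact: aC].
have psiE k j : alpha k (psi j) = \sum_i rho k i j *: psi i.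
  rewrite mean_act //.
  transitivity (mean mul (fun g => b j (mul (inv k) g) *: alpha g x0)).
    rewrite -[RHS](mean_mull cg k).
      congr mean; apply/funext => g; rewrite mA mVl m1l aM.
      by rewrite -[b j g *: alpha g x0]addr0 aL linear_map0 // addr0.
    move=> g; apply: cvgZ; last exact: aC.
    exact: (continuous_comp_mull cg (k := inv k) (@cb j)).
  transitivity (mean mul (fun g => \sum_i rho k i j *: (b i g *: alpha g x0))).
    congr mean; apply/funext => g; rewrite bT scaler_suml.
    by apply: eq_bigr => i _; rewrite scalerA.
  rewrite (@mean_sum _ _ _ _ _ cg W _ _ (fun i g => rho k i j *: (b i g *: alpha g x0))).
    by apply: eq_bigr => i _; rewrite (meanZ cg).
  by move=> i g; apply: cvgZr; exact: cpsi.
pose T (v : 'cV[R]_n) := \sum_j v j 0 *: psi j.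
exists n, rho, T; split=> //.
- split.
    move=> a v w; rewrite /T scaler_sumr -big_split; apply: eq_bigr => j _.
    by rewrite !mxE scalerDl scalerA.
  move=> g v; rewrite /T linear_map_sum //.
  under eq_bigr do rewrite psiE scaler_sumr.
  rewrite exchange_big /=; apply: eq_bigr => i _; rewrite mxE scaler_suml.
  by apply: eq_bigr => j _; rewrite scalerA mulrC.
- exists (delta_mx j0 0) => DT; apply: bj0.
  have [_ E] := mean_linear_comp cg LL Lb (@cpsi j0).
  have -> : (fun g => b j0 g * u g) = fun g => L (b j0 g *: alpha g x0).
    apply/funext => g; have L0 : L 0 = 0.
      by have := LL (-1) 0 0; rewrite scaler0 add0r scaleN1r addNr.
    by rewrite -[b j0 g *: _]addr0 LL L0 addr0.
  rewrite E -/(psi j0).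
  have TE : T (delta_mx j0 0) = psi j0.
    rewrite /T (bigD1 j0) //= big1 ?addr0; first by rewrite mxE !eqxx scale1r.
    by move=> j jj; rewrite mxE (negbTE jj) scale0r.
  have l0 : l 0 = 0 by have := lL (-1) 0 0; rewrite scaler0 add0r mulN1r addNr.
  by rewrite /L -TE DT l0.
Qed.

(* A representation of minimal dimension detecting D is irreducible: an invariant
   subspace is the range of an idempotent q commuting with rho, and q or 1 - q
   would give a smaller one. *)
Lemma irreducible_detects x0 : D x0 <> 0 ->
  exists n (rho : G -> 'M[R]_n) T,
    [/\ irreducible_real_rep mul e rho, intertwining_embedding alpha rho T &
        exists v, D (T v) <> 0].
Proof.
move=> Dx0; have [DL _] := bD.
pose P n := `[< exists (rho : G -> 'M[R]_n) T,
  [/\ real_rep mul e rho, equivariant_map rho T & exists v, D (T v) <> 0] >].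
have exP : exists n, P n.
  have [n [rho [T h]]] := finite_dim_detects Dx0.
  by exists n; apply/asboolP; exists rho, T.
case: (ex_minnP exP) => n /asboolP[rho [T [rrho [TL Teq] [v0 Dv0]]]] nmin.
have [r1 rM rC] := rrho.
have T0 : T 0 = 0 by have := TL (-1) 0 0; rewrite scaler0 add0r scaleN1r addNr.
(* Through [q = C B] the range of [q] carries a representation of dimension [\rank q]; if it still
   detects [D], minimality of [n] applies. *)
have cut (q : 'M[R]_n) v : q *m q = q -> (forall g, rho g *m q = q *m rho g) ->
    D (T (q *m v)) <> 0 -> (n <= \rank q)%N.
  move=> qq qc Dq; apply: nmin; apply/asboolP.
  have [C [B [CB BC]]] := idempotent_factor qq.
  move: (\rank q) C B CB BC => r C B CB BC.
  exists (fun g => B *m rho g *m C), (fun c => T (C *m c)); split.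
  - split.
    + by rewrite r1 mulmx1.
    + move=> g h; rewrite rM.
      have -> : B *m rho g *m C *m (B *m rho h *m C) =
          B *m (rho g *m (C *m B)) *m rho h *m C by rewrite !mulmxA.
      by rewrite CB qc -CB !mulmxA BC mul1mx.
    + apply: (@mxcontinuous_mul _ _ _ _ _ (fun g => B *m rho g)); last exact: mxcontinuous_cst.
      by apply: mxcontinuous_mul => //; exact: mxcontinuous_cst.
  - split; first by move=> a x y; rewrite mulmxDr -scalemxAr TL.
    move=> g c; rewrite Teq; congr T.
    by rewrite !mulmxA CB -qc -CB -!mulmxA [B *m _]mulmxA BC mul1mx.
  - by exists (B *m v); rewrite mulmxA CB.
have irr : irreducible_real_rep mul e rho.
  split=> //.
    rewrite lt0n; apply/eqP => n0; apply: Dv0.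
    have -> : v0 = 0 by apply/matrixP => i; have := ltn_ord i; rewrite {2}n0.
    by rewrite T0 linear_map0.
  move=> S S0 SL Sinv.
  have [p [Z [SZ Sp pS]]] := subspace_projection S0 SL.
  (* Averaging the projection [p] keeps its range in [S] and its action on [S], so [q] is an
     idempotent with range [S] that commutes with [rho]. *)
  pose q := conj_mean mul inv rho p.
  have cc := continuous_conj cg rrho (p := p).
  have qc g : rho g *m q = q *m rho g by exact: (conj_mean_comm cg rrho).
  have Zq : Z *m q = 0.
    rewrite -(mxmean_mull cg) // -[RHS](mxmean_cst cg (0 : 'M[R]_n)).
    congr mxmean; apply/funext => g; apply/matrixP => i j.
    have /matrixP /(_ i 0) := (SZ _).1 (Sinv g _ (Sp (rho (inv g) *m delta_mx j 0))).
    rewrite !mulmxA -[_ *m delta_mx j 0]colE !mxE.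
    by under eq_bigr do rewrite -!mulmxA.
  have qS v : S v -> q *m v = v.
    move=> Sv; rewrite -(mxmean_mulr cg) // -[RHS](mxmean_cst cg v).
    congr mxmean; apply/funext => g.
    by rewrite -!mulmxA pS ?(rep_Kinv cg rrho) ?mulmxA ?(rep_Kinv cg rrho) ?mul1mx //; exact: Sinv.
  have Sq v : S (q *m v) by apply/SZ; rewrite mulmxA Zq mul0mx.
  have qq : q *m q = q.
    apply/matrixP => i j.
    have /matrixP /(_ i 0) := qS _ (Sq (delta_mx j 0)).
    by rewrite mulmxA -!colE !mxE.
  pose q' := 1%:M - q.
  have qq' : q' *m q' = q'.
    by rewrite mulmxBl mul1mx mulmxBr mulmx1 qq subrr subr0.
  have qc' g : rho g *m q' = q' *m rho g.
    by rewrite mulmxBl mulmxBr mul1mx mulmx1 qc.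
  have full (r : 'M[R]_n) : r *m r = r -> (n <= \rank r)%N -> r = 1%:M.
    move=> rr rn; have ru : r \in unitmx.
      by rewrite -row_free_unit /row_free eqn_leq rank_leq_row.
    by rewrite -[LHS](mulKmx ru) rr mulVmx.
  (* [v0] is the sum of its images under [q] and [q'], so one of these idempotents detects [D],
     hence has full rank and is the identity. *)
  have [Dq|Dq] := pselect (D (T (q *m v0)) = 0).
    have Dq' : D (T (q' *m v0)) <> 0.
      move=> h; apply: Dv0.
      have -> : v0 = 1 *: (q *m v0) + q' *m v0.
        by rewrite scale1r mulmxBl mul1mx addrC subrK.
      by rewrite TL DL Dq h scaler0 addr0.
    left; have q0 : q = 0.
      have /eqP := full _ qq' (cut _ _ qq' qc' Dq').
      by rewrite -subr_eq0 /q' addrAC subrr sub0r oppr_eq0 => /eqP.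
    apply/seteqP; split => v /=; last by move=> ->.
    by move=> /qS; rewrite q0 mul0mx.
  right; apply/seteqP; split => // v _.
  have q1 := full _ qq (cut _ _ qq qc Dq).
  by rewrite -[v]mul1mx -q1; exact: Sq.
exists n, rho, T; split=> //; last by exists v0.
split=> //; apply: (equivariant_injective irr (v0 := v0)) => // Tv0.
by case: Dv0; rewrite Tv0 linear_map0.
Qed.
End Detect.
End Rep.

(** * Invariant projections *)

Lemma bounded_linear_closure0 (R : realType) (W : normedModType R) (f : W -> W)
    (A : set W) x : is_bounded_linear f -> (forall a, A a -> f a = 0) ->
  closure A x -> f x = 0.
Proof.
move=> [fl [c fc]] fA clx; apply: eq_of_dist_le => eps e0; rewrite subr0.
pose d := `|c| + 1.
have d0 : 0 < d by rewrite ltr_pwDr.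
have ed : 0 < eps / d by rewrite divr_gt0.
have [a [Aa /= ax]] := clx _ (nbhsx_ballx x _ ed).
rewrite -[f x]subr0 -(fA _ Aa) -linear_mapB //.
apply: le_trans (fc _) _; move: ax; rewrite -ball_normE /= => /ltW ax.
apply: (@le_trans _ _ (d * `|x - a|)); last by rewrite mulrC -ler_pdivlMr.
by apply: ler_wpM2r => //; apply: le_trans (ler_norm c) _; rewrite lerDl.
Qed.

Lemma lin_span_sub (R : realType) (W : normedModType R) (A V : set W) :
  is_lin_subspace V -> A `<=` V -> lin_span A `<=` V.
Proof.
move=> [V0 VL] AV _ [k [c [s [As ->]]]].
elim: (index_enum _) => [|i r IH]; first by rewrite big_nil.
by rewrite big_cons; apply: (VL _) => //; apply: AV.
Qed.

Lemma opnorm_ge (R : realType) (W : normedModType R) (f : W -> W) x :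
  is_bounded_linear f -> `|x| <= 1 -> `|f x| <= opnorm f.
Proof.
move=> [_ [c fc]] x1; apply: ub_le_sup; last by exists x.
exists `|c| => _ [y /= y1 <-]; apply: le_trans (fc y) _.
apply: le_trans (ler_wpM2r (normr_ge0 y) (ler_norm c)) _.
by rewrite ler_piMr.
Qed.

Lemma opnorm_le (R : realType) (W : normedModType R) (f : W -> W) (m : R) :
  (forall x, `|x| <= 1 -> `|f x| <= m) -> opnorm f <= m.
Proof.
move=> fm; apply: ge_sup; first by exists `|f 0|, 0 => //=; rewrite normr0.
by move=> _ [x /= x1 <-]; apply: fm.
Qed.

Section Projections.
Variables (R : realType) (W : completeNormedModType R) (G : topologicalType).
Variables (mul : G -> G -> G) (inv : G -> G) (e : G) (alpha : G -> W -> W).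
Variable V : set W.
Hypothesis cg : compact_group mul inv e.
Hypothesis rep : isometric_rep mul e alpha.
Hypotheses (clV : closed V) (subV : is_lin_subspace V).
Hypothesis invV : alpha_invariant_set alpha V.

Let cinv : continuous inv. Proof. by case: cg => _ []. Qed.
Let aL : forall g, is_linear_map (alpha g). Proof. by case: rep. Qed.
Let aM : forall g h x, alpha (mul g h) x = alpha g (alpha h x). Proof. by case: rep. Qed.
Let aN : forall g x, `|alpha g x| = `|x|. Proof. by case: rep. Qed.
Let aC : forall x, continuous (fun g => alpha g x). Proof. by case: rep. Qed.
Let aCV x : continuous (fun g => alpha (inv g) x).
Proof. exact: continuous_compose cinv (@aC x). Qed.

Definition avg_proj (Q : W -> W) (x : W) : W :=
  mean mul (fun g => alpha g (Q (alpha (inv g) x))).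

Let cavg Q x : is_bounded_linear Q ->
  continuous (fun g => alpha g (Q (alpha (inv g) x))).
Proof.
move=> [Ql [c Qc]]; apply: (continuous_act rep).
by have [] := mean_linear_comp cg Ql Qc (@aCV x).
Qed.

Lemma avg_proj_norm Q x (c : R) : is_bounded_linear Q ->
  (forall g, `|Q (alpha g x)| <= c) -> `|avg_proj Q x| <= c.
Proof.
move=> bQ Qc; apply: (mean_norm_le cg); first exact: cavg.
by move=> g; rewrite aN.
Qed.

Lemma avg_proj_projection Q : is_projection_onto V Q -> is_projection_onto V (avg_proj Q).
Proof.
move=> [bQ QV QId]; have [Ql [c Qc]] := bQ; split.
- split.
    move=> a x y; rewrite /avg_proj -(mean_linear cg); try exact: cavg.
    by congr mean; apply/funext => g; rewrite aL Ql aL.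
  exists c => x; apply: avg_proj_norm => // g.
  by apply: le_trans (Qc _) _; rewrite aN.
- by move=> x; apply: (mean_closed cg) => // [|g]; [exact: cavg | exact: invV].
- move=> x Vx; rewrite -[RHS](mean_cst cg x); congr mean; apply/funext => g.
  by rewrite QId ?(rep_Kinv_act cg rep) //; exact: invV.
Qed.

Lemma avg_proj_invariant Q : is_bounded_linear Q ->
  alpha_invariant_map inv alpha (avg_proj Q).
Proof.
move=> bQ h x; rewrite (mean_act cg rep); last exact: cavg.
rewrite /avg_proj -[RHS](mean_mull cg h); last exact: cavg.
by congr mean; apply/funext => g; rewrite (group_invM cg) !aM.
Qed.

Lemma invariant_map_comm P : alpha_invariant_map inv alpha P ->
  forall g x, P (alpha g x) = alpha g (P x).
Proof. by move=> iP g x; rewrite -(iP g) (rep_invK_act cg rep). Qed.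

Lemma isotypic_embedding n (rho : G -> 'M[R]_n) T v :
  intertwining_embedding alpha rho T -> isotypic alpha rho (T v).
Proof.
move=> eT; apply: subset_closure; exists 1%N, (fun=> 1), (fun=> T v); split.
  by move=> _; exists T; split => //; exists v.
by rewrite big_ord1 scale1r.
Qed.

Lemma isotypic_sub n (rho : G -> 'M[R]_n) :
  (forall T v, intertwining_embedding alpha rho T -> V (T v)) ->
  isotypic alpha rho `<=` V.
Proof.
move=> h; rewrite /isotypic; have /closure_id -> := clV.
by apply: closureS; apply: lin_span_sub => // _ [T [eT [v ->]]]; exact: h.
Qed.

Lemma full_unique P Q : alpha_full mul e alpha V ->
  is_projection_onto V P -> alpha_invariant_map inv alpha P ->
  is_projection_onto V Q -> alpha_invariant_map inv alpha Q -> P = Q.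
Proof.
move=> fV [bP PV PId] iP [bQ QV QId] iQ.
have [Pl [c Pc]] := bP; have [Ql [d Qd]] := bQ.
pose D x := P x - Q x.
have Dl : is_linear_map D.
  by move=> a x y; rewrite /D Pl Ql opprD addrACA scalerBr.
have bD : is_bounded_linear D.
  split=> //; exists (c + d) => x; apply: le_trans (ler_normB _ _) _.
  by rewrite mulrDl lerD.
have eqD g x : D (alpha g x) = alpha g (D x).
  by rewrite /D (invariant_map_comm iP) (invariant_map_comm iQ) (linear_mapB _ _ (@aL g)).
have DV x : V (D x).
  by rewrite /D addrC -scaleN1r; apply: subV.2.
apply/funext => x; apply: contrapT => PQ.
have [|n [rho [T [irr eT [v Dv]]]]] := irreducible_detects cg rep bD (x0 := x).
  by move=> /eqP; rewrite subr_eq0 => /eqP.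
have [TL Tinj Teq] := eT.
(* Composing with [D] gives a second copy of [rho], now inside [V], so fullness forces the first
   copy into [V] as well. *)
have eDT : equivariant_map alpha rho (fun w => D (T w)).
  by split=> [a w w'|g w]; rewrite ?TL ?Dl // -eqD Teq.
have iDT : intertwining_embedding alpha rho (fun w => D (T w)).
  have [h1 h2] := eDT; split=> //.
  exact: (equivariant_injective rep irr eDT Dv).
have VE : V `&` isotypic alpha rho = isotypic alpha rho.
  apply: fV => //.
  exists (D (T v)); split; first exact: DV.
  by split; [exact: (@isotypic_embedding n rho (fun w => D (T w)) v iDT) | exact: Dv].
apply: Dv.
have : isotypic alpha rho (T v) by exact: isotypic_embedding.
by rewrite -VE => -[VT _]; rewrite /D PId // QId // subrr.
Qed.

(** Expanding [S] in the standard basis reduces the claim to scalar means of the coordinates. *)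
Lemma mean_linear_cV n (S : 'cV[R]_n -> W) (F : G -> 'cV[R]_n) :
  (forall (a : R) v w, S (a *: v + w) = a *: S v + S w) -> mxcontinuous F ->
  mean mul (fun g => S (F g)) = S (mxmean mul F).
Proof.
move=> SL cF.
have S0 : S 0 = 0 by have := SL (-1) 0 0; rewrite scaler0 add0r scaleN1r addNr.
have SE w : S w = \sum_i w i 0 *: S (delta_mx i 0).
  have {1}-> : w = \sum_i w i 0 *: delta_mx i 0.
    by rewrite {1}[w]matrix_sum_delta; apply: eq_bigr => i _; rewrite big_ord1.
  elim: (index_enum _) => [|i r IH]; first by rewrite !big_nil.
  by rewrite !big_cons SL IH.
have cS i : continuous (fun g => F g i 0 *: S (delta_mx i 0)).
  by move=> g; apply: cvgZ; [exact: cF | exact: cvg_cst].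
rewrite SE; under [in LHS]eq_fun do rewrite SE.
rewrite (@mean_sum _ _ _ _ _ cg W _ _ (fun i g => F g i 0 *: S (delta_mx i 0))) //.
apply: eq_bigr => i _; rewrite mxE.
have h1 (a : R) (x y : R) : (a *: x + y) *: S (delta_mx i 0) =
    a *: (x *: S (delta_mx i 0)) + y *: S (delta_mx i 0).
  by rewrite scalerDl scalerA.
have h2 (x : R) : `|x *: S (delta_mx i 0)| <= `|S (delta_mx i 0)| * `|x|.
  by rewrite normrZ mulrC.
by have [_ ->] := @mean_linear_comp _ _ _ _ _ cg R W _ _ (fun g => F g i 0) h1 h2 (@cF i 0).
Qed.

(* If V meets the isotypic component of rho without containing it, adding to an
   invariant projection P the average of the rank-one operators
   x |-> l (alpha_g^-1 (x - P x)) alpha_g s0 gives another one. *)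
Lemma unique_full :
  (exists P, is_projection_onto V P /\ alpha_invariant_map inv alpha P) ->
  (forall P Q : W -> W,
    is_projection_onto V P -> alpha_invariant_map inv alpha P ->
    is_projection_onto V Q -> alpha_invariant_map inv alpha Q -> P = Q) ->
  alpha_full mul e alpha V.
Proof.
move=> [P [pP iP]] uniq n rho irr [x [Vx [ix x0]]].
have [bP PV PId] := pP; have [Pl [c Pc]] := bP.
have eqP' := invariant_map_comm iP.
apply/seteqP; split => [y []//|y iy]; split=> //; move: y iy.
(* If [P] vanished on every copy of [rho] it would vanish on the isotypic component, whereas
   [P x = x <> 0]. *)
have [T0 [w0 [eT0 PT0]]] : exists T w, intertwining_embedding alpha rho T /\ P (T w) <> 0.
  apply: contrapT => nT; apply: x0; rewrite -(PId x Vx).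
  apply: (bounded_linear_closure0 bP) ix => _ [k [b [s [sP ->]]]].
  rewrite linear_map_sum //; apply: big1 => i _.
  have [T [eT [w ->]]] := sP i.
  have [->|PN] := pselect (P (T w) = 0); first by rewrite scaler0.
  by case: nT; exists T, w.
pose S w := P (T0 w).
have eS : equivariant_map alpha rho S.
  by have [T0L _ T0eq] := eT0; split=> [a v w|g v]; rewrite /S ?T0L ?Pl // -eqP' T0eq.
have [SL Seq] := eS.
have injS : injective S := equivariant_injective rep irr eS PT0.
(* If the component is not inside [V], some copy [T] of [rho] has a vector [T v0] outside [V]; then
   [T'], the part of [T] in the kernel of [P], is nonzero at [v0]. *)
apply: isotypic_sub => T v0 [TL _ Teq]; apply: contrapT => nV.
pose T' w := T w - P (T w).
have T'v0 : T' v0 <> 0.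
  by move=> /eqP; rewrite subr_eq0 => /eqP TE; apply: nV; rewrite TE.
have [l [lL lb lN]] := norming_functional T'v0.
have lL' (a : R) y z : l (a *: y + z) = a *: l y + l z by rewrite lL.
have lb' y : `|l y| <= 1 * `|y| by rewrite mul1r.
pose s0 := S v0.
pose F y g := l (alpha (inv g) (y - P y)) *: alpha g s0.
have cF y : continuous (F y).
  move=> g; apply: cvgZ; last exact: aC.
  by have [h _] := mean_linear_comp cg lL' lb' (@aCV (y - P y)); exact: h.
pose D y := mean mul (F y).
have FL (a : R) y z g : F (a *: y + z) g = a *: F y g + F z g.
  rewrite /F scalerA -scalerDl -lL -aL; congr (l (alpha _ _) *: _).
  by rewrite Pl opprD addrACA scalerBr.
have Dl : is_linear_map D.
  move=> a y z; rewrite /D -(mean_linear cg) //.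
  by congr mean; apply/funext => g; exact: FL.
have DV y : V (D y).
  apply: (mean_closed cg) => // g; rewrite /F -[_ *: _]addr0; apply: subV.2; last exact: subV.1.
  by apply: invV; exact: PV.
have D0 y : V y -> D y = 0.
  move=> Vy; rewrite -[RHS](mean_cst cg (0 : W)); congr mean; apply/funext => g.
  rewrite /F PId // subrr linear_map0 //.
  have -> : l 0 = 0 by have := lL (-1) 0 0; rewrite scaler0 add0r mulN1r addNr.
  by rewrite scale0r.
have eqD h y : D (alpha h y) = alpha h (D y).
  rewrite /D (mean_act cg rep) // -(mean_mull cg h) //; congr mean; apply/funext => g.
  rewrite /F (group_invM cg) aM eqP' -linear_mapB // (rep_invK_act cg rep).
  by rewrite -[l _ *: alpha g s0]addr0 aL linear_map0 // addr0 aM.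
pose Q y := P y + D y.
have pQ : is_projection_onto V Q.
  split.
  - split.
      by move=> a y z; rewrite /Q Pl Dl scalerDr addrACA.
    exists (c + (1 + c) * `|s0|) => y; apply: le_trans (ler_normD _ _) _.
    rewrite mulrDl lerD //; apply: (mean_norm_le cg) => // g.
    rewrite /F normrZ aN mulrAC; apply: ler_wpM2r => //.
    apply: le_trans (lb _) _; rewrite aN; apply: le_trans (ler_normB _ _) _.
    by rewrite mulrDl mul1r lerD.
  - by move=> y; rewrite /Q -[P y]scale1r; apply: subV.2.
  - by move=> y Vy; rewrite /Q PId // D0 // addr0.
have iQ : alpha_invariant_map inv alpha Q.
  move=> g y; rewrite /Q eqP' eqD -[alpha (inv g) (P y)]scale1r -aL scale1r.
  exact: (rep_Kinv_act cg rep).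
have PQ := uniq _ _ pP iP pQ iQ.
have DT y : D y = 0.
  have /(congr1 (fun f => f y)) := PQ; rewrite /Q => /eqP.
  by rewrite -subr_eq0 opprD addrA subrr sub0r oppr_eq0 => /eqP.
(* The row vector representing the functional [l] on the copy [T']. *)
pose phi : 'rV[R]_n := \row_j l (T' (delta_mx j 0)).
have T'L (a : R) v w : T' (a *: v + w) = a *: T' v + T' w.
  by rewrite /T' TL Pl opprD addrACA scalerBr.
have T'eq g v : alpha g (T' v) = T' (rho g *m v).
  by rewrite /T' linear_mapB // -eqP' Teq.
have phiE w : l (T' w) = (phi *m w) 0 0.
  rewrite mxE (_ : \sum_j _ = \sum_j w j 0 * l (T' (delta_mx j 0))); last first.
    by apply: eq_bigr => j _; rewrite mxE mulrC.
  have {1}-> : w = \sum_i w i 0 *: delta_mx i 0.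
    by rewrite {1}[w]matrix_sum_delta; apply: eq_bigr => i _; rewrite big_ord1.
  elim: (index_enum _) => [|i r IH].
    rewrite !big_nil; have := T'L (-1) 0 0; rewrite scaler0 add0r scaleN1r addNr => ->.
    by have := lL (-1) 0 0; rewrite scaler0 add0r mulN1r addNr.
  by rewrite !big_cons T'L lL IH.
have [rrho _ _] := irr.
(* [D] corresponds to [A] in coordinates: [D (T w) = S (A *m w)]. Since [D] vanishes and [S] is
   injective, [A = 0], yet its trace is that of [v0 *m phi], namely [l (T' v0) <> 0]. *)
pose A := conj_mean mul inv rho (v0 *m phi).
have A0 : A = 0.
  apply/matrixP => i j.
  pose w : 'cV[R]_n := delta_mx j 0.
  suff Aw : A *m w = 0.
    by have := congr1 (fun M : 'cV[R]_n => M i 0) Aw; rewrite -colE !mxE.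
  apply: injS.
  have -> : S 0 = 0 by have := SL (-1) 0 0; rewrite scaler0 add0r scaleN1r addNr.
  rewrite -(DT (T w)) /D.
  have cc := continuous_conj cg rrho (p := v0 *m phi).
  rewrite -(mxmean_mulr cg) // -mean_linear_cV //; last first.
    by apply: mxcontinuous_mul => //; exact: mxcontinuous_cst.
  congr mean; apply/funext => g; rewrite /F -/(T' w) T'eq phiE.
  rewrite Seq -[_ *: S _]addr0.
  have <- : S 0 = 0 by have := SL (-1) 0 0; rewrite scaler0 add0r scaleN1r addNr.
  rewrite -SL addr0; congr S.
  rewrite -!mulmxA [X in _ *m (_ *m X)]mx11_scalar mul_mx_scalar -scalemxAr.
  by rewrite mulmxA.
have := conj_mean_trace cg rrho (v0 *m phi); rewrite -/A A0 mxtrace0 mxtrace_mulC trace_mx11.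
by rewrite -phiE => /esym.
Qed.

End Projections.

Unset Implicit Arguments.

Theorem theorem6p3 (R : realType) (W : completeNormedModType R)
  (G : topologicalType) (mul : G -> G -> G) (inv : G -> G) (e : G)
  (alpha : G -> W -> W) (V : set W) :
  compact_group mul inv e ->
  isometric_rep mul e alpha ->
  closed V -> is_lin_subspace V -> alpha_invariant_set alpha V ->
  (exists P : W -> W, is_projection_onto V P) ->
  [/\ (exists P : W -> W, is_projection_onto V P /\ alpha_invariant_map inv alpha P),
      ((forall P Q : W -> W,
          is_projection_onto V P -> alpha_invariant_map inv alpha P ->
          is_projection_onto V Q -> alpha_invariant_map inv alpha Q -> P = Q)
        <-> alpha_full mul e alpha V) &
      (alpha_full mul e alpha V ->
        forall P : W -> W,
          is_projection_onto V P -> alpha_invariant_map inv alpha P ->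
          forall Q : W -> W, is_projection_onto V Q -> opnorm P <= opnorm Q)].
Proof.
move=> cg rep clV subV invV [P0 pP0].
have bP0 : is_bounded_linear P0 by case: pP0.
have exP : exists P, is_projection_onto V P /\ alpha_invariant_map inv alpha P.
  exists (avg_proj mul inv alpha P0); split; first exact: (avg_proj_projection cg rep clV subV invV).
  exact: (avg_proj_invariant cg rep).
split=> //.
- split; first exact: (unique_full cg rep clV subV invV).
  by move=> fV P Q; exact: (full_unique cg rep subV).
- move=> fV P pP iP Q pQ; have bQ : is_bounded_linear Q by case: pQ.
  (* By uniqueness [P] is the average of any competitor [Q], and averaging over isometries does not
     increase the norm. *)
  have -> : P = avg_proj mul inv alpha Q.
    apply: (full_unique cg rep subV fV) => //; first exact: (avg_proj_projection cg rep clV subV invV).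
    exact: (avg_proj_invariant cg rep).
  apply: opnorm_le => x x1; apply: (avg_proj_norm cg rep) => // g.
  by apply: opnorm_ge => //; have [_ _ _ -> _] := rep.
Qed.
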